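(* Fix an integer $d\geq 2$ and a real number $q\geq 1$. Then $$\lim_{p\to\infty}\frac{\delta\!\left(H_q(d,p)\right)}{p^d}=\frac{\left(2\Gamma\!\left(\frac{1}{q}+1\right)\right)^d}{2\,\Gamma\!\left(\frac{d}{q}+1\right)\zeta(d)}.$$
   Context: A point of $\mathbb{Z}^d$ is primitive if it is nonzero and the greatest common divisor of its coordinates is $1$. For $p>0$, $H_q(d,p)$ is the zonotope (Minkowski sum of segments) $\sum_x [0,x]$, where $x$ ranges over all primitive points of $\mathbb{Z}^d$ with $\|x\|_q\leq p$ whose first nonzero coordinate is positive. For a polytope $P$, $\delta(P)$ denotes the diameter of the graph of $P$ (vertices and edges). $\Gamma$ is Euler's gamma function and $\zeta$ the Riemann zeta function. *)

(* Defs.v *)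
From HB Require Import structures.
From mathcomp Require Import all_boot all_order all_algebra.
From mathcomp Require Import all_classical all_reals all_analysis.

Set Implicit Arguments.
Unset Strict Implicit.
Unset Printing Implicit Defensive.

Import Order.TTheory GRing.Theory Num.Theory.
Import numFieldNormedType.Exports.

Local Open Scope classical_set_scope.
Local Open Scope ring_scope.

Section Convexity.
Variable R : realType.

Definition segment (V : lmodType R) (u v : V) : set V :=
  [set (1 - t) *: u + t *: v | t in `[0, 1]].

(* Only meaningful for finite [A]: [\sum_(i \in A)] is a finitely supported
   sum, with value 0 when the support is infinite. *)
Definition minkowski_sum (I : choiceType) (V : lmodType R)
    (A : set I) (F : I -> set V) : set V :=
  [set \sum_(i \in A) f i | f in [set f : I -> V | forall i, A i -> F i (f i)]].

Definition dotp (d : nat) (x y : 'rV[R]_d) : R := \sum_(i < d) x 0 i * y 0 i.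

(* The face of [P] cut out by the supporting hyperplane with outer normal [c];
   [c = 0] yields [P] itself. *)
Definition face (d : nat) (P : set 'rV[R]_d) (c : 'rV[R]_d) : set 'rV[R]_d :=
  [set x | P x /\ forall y, P y -> dotp c y <= dotp c x].

Definition vertex (d : nat) (P : set 'rV[R]_d) : set 'rV[R]_d :=
  [set v | exists c, face P c = [set v]].

(* The one-dimensional faces of a polytope are its faces of the form [u, v]
   with [u] and [v] distinct. *)
Definition adjacent (d : nat) (P : set 'rV[R]_d) (u v : 'rV[R]_d) : Prop :=
  [/\ vertex P u, vertex P v, u <> v & exists c, face P c = segment u v].

End Convexity.

Section Diameter.
Variables (R : realType) (T : eqType) (V : set T) (E : T -> T -> Prop).

Definition walk (n : nat) (u v : T) : Prop :=
  exists s : seq T,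
    [/\ size s = n, path (fun x y => `[< E x y >]) u s & last u s = v].

(* [+oo] when [v] cannot be reached from [u] *)
Definition graph_dist (u v : T) : \bar R :=
  ereal_inf [set (n%:R)%:E | n in [set n : nat | walk n u v]].

Definition graph_diameter : \bar R :=
  ereal_sup [set graph_dist e.1 e.2 | e in V `*` V].

End Diameter.

Definition diameter (R : realType) (d : nat) (P : set 'rV[R]_d) : \bar R :=
  graph_diameter R (vertex P) (adjacent P).

Section PrimitiveZonotope.
Variable R : realType.

Definition primitive_point (d : nat) (x : 'rV[int]_d) : Prop :=
  x <> 0 /\ \big[gcdn/0%N]_(i < d) absz (x 0 i) = 1%N.

Definition first_nonzero_pos (d : nat) (x : 'rV[int]_d) : Prop :=
  exists2 i : 'I_d, 0 < x 0 i & forall j : 'I_d, (j < i)%N -> x 0 j = 0.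

Definition toR (d : nat) (x : 'rV[int]_d) : 'rV[R]_d := map_mx intr x.

Definition qnorm (q : R) (d : nat) (x : 'rV[R]_d) : R :=
  (\sum_(i < d) `|x 0 i| `^ q) `^ q^-1.

Definition generators (q : R) (d : nat) (p : R) : set 'rV[int]_d :=
  [set x | [/\ primitive_point x, qnorm q (toR x) <= p & first_nonzero_pos x]].

Definition zonotopeH (q : R) (d : nat) (p : R) : set 'rV[R]_d :=
  minkowski_sum (@generators q d p) (fun x => segment 0 (toR x)).

End PrimitiveZonotope.

Arguments zonotopeH {R} q d p _.

Section SpecialFunctions.
Variable R : realType.

(* Euler's integral, for [0 < a] *)
Definition Gamma (a : R) : R :=
  (\int[@lebesgue_measure R]_(t in `]0%R, +oo[) (t `^ (a - 1) * expR (- t)))%R.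

(* for [1 < s] *)
Definition zeta (s : R) : R :=
  limn (series (fun n : nat => (n.+1%:R `^ s)^-1)).

End SpecialFunctions.

(* Main.v *)
(** Let [c] be a generic linear functional. The vertex of a zonotope that
    maximises [c] is the sum of the generators on which [c] is positive, so if
    the generators are pairwise independent, an edge flips the sign of one
    generator. Opposite vertices thus lie at distance at least the number of
    generators, and moving the functional along a generic segment joins any two
    vertices by a path that flips each generator at most once: the diameter is
    the number of generators.

    It remains to count primitive points. Let [B(p)] be the number of lattice
    points of [q]-norm at most [p]. Rounding gives [B(m p) <= m^d B(p + d)], so
    [B(p) / p^d] tends to some [V], by a Fekete type argument. The value of [V]
    comes from the Laplace sums [\sum_x exp (- |x|_q^q / m)]: by the layer cake
    formula and dominated convergence they grow like
    [V Gamma(d/q + 1) m^(d/q)], while they are also the [d]-th power of the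
    one-dimensional sum, for which [V = 2].

    Finally [B(p) - 1 = 2 \sum_(k >= 1) G(p/k)], where [G] counts the
    generators. The error [e(p) = 2 G(p) / p^d - V / zeta(d)] therefore
    satisfies [limsup |e| <= (zeta(d) - 1) limsup |e|], and [zeta(d) - 1 <= 3/4]. *)

Require Import Defs.
From HB Require Import structures.
From mathcomp Require Import all_boot all_order all_algebra finmap.
From mathcomp Require Import all_classical all_reals all_analysis measurable_realfun.
From mathcomp Require Import ring lra zify.

Set Implicit Arguments.
Unset Strict Implicit.
Unset Printing Implicit Defensive.

Import Order.TTheory GRing.Theory Num.Theory.
Import numFieldNormedType.Exports.
Local Open Scope classical_set_scope.
Local Open Scope ring_scope.

(** * Zonotopes *)

Section DotProduct.
Variables (R : realType) (d : nat).
Implicit Types (c x y : 'rV[R]_d).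

Lemma dotpDr c x y : dotp c (x + y) = dotp c x + dotp c y.
Proof. by rewrite /dotp -big_split; apply: eq_bigr => i _; rewrite mxE mulrDr. Qed.

Lemma dotpZr c a x : dotp c (a *: x) = a * dotp c x.
Proof. by rewrite /dotp mulr_sumr; apply: eq_bigr => i _; rewrite mxE mulrCA. Qed.

Lemma dotpC x y : dotp x y = dotp y x.
Proof. by apply: eq_bigr => i _; rewrite mulrC. Qed.

Lemma dotpDl c x y : dotp (x + y) c = dotp x c + dotp y c.
Proof. by rewrite dotpC dotpDr !(dotpC c). Qed.

Lemma dotpZl c a x : dotp (a *: x) c = a * dotp x c.
Proof. by rewrite dotpC dotpZr dotpC. Qed.

Lemma dotp0r c : dotp c 0 = 0.
Proof. by rewrite -(scale0r 0) dotpZr mul0r. Qed.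

Lemma dotp_sumr (J : finType) (P : pred J) c (F : J -> 'rV[R]_d) :
  dotp c (\sum_(j | P j) F j) = \sum_(j | P j) dotp c (F j).
Proof.
by apply: (big_morph (dotp c) _ (dotp0r c)) => x y; rewrite dotpDr.
Qed.

Lemma dotp_gt0 x : x != 0 -> 0 < dotp x x.
Proof.
move=> x0; rewrite lt_neqAle eq_sym sumr_ge0 ?andbT; last first.
  by move=> i _; rewrite -expr2 sqr_ge0.
apply: contra x0 => /eqP/psumr_eq0P x0; apply/eqP/rowP => i; rewrite mxE.
apply/eqP; rewrite -sqrf_eq0 expr2 x0 // => j _.
by rewrite -expr2 sqr_ge0.
Qed.

(** Nonzero signs of finitely many linear forms survive a small enough move; one step size is found
    by induction, as a minimum. *)
Lemma small_shift (s : seq 'rV[R]_d) c e : exists2 eps : R, 0 < eps &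
  forall w, w \in s ->
    (0 < dotp c w -> 0 < dotp (c + eps *: e) w) /\
    (dotp c w < 0 -> dotp (c + eps *: e) w < 0).
Proof.
elim: s => [|w s [eps e0 IH]]; first by exists 1.
have pos2 : 0 < `|dotp e w| + 1 by rewrite ltr_wpDl.
have [c0|c0] := eqVneq (dotp c w) 0.
  exists eps => // v; rewrite inE => /orP[/eqP->|/IH//].
  by rewrite c0 ltxx.
have pos1 : 0 < `|dotp c w| / (`|dotp e w| + 1).
  by rewrite divr_gt0 // normr_gt0.
(* The [+ 1] keeps the denominator positive and makes the change at [w] strictly smaller than
   [dotp c w] in absolute value. *)
exists (Num.min eps (`|dotp c w| / (`|dotp e w| + 1))).
  by rewrite lt_min e0.
set m := Num.min _ _ => v.
have m0 : 0 < m by rewrite lt_min e0.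
have me : m <= eps by rewrite ge_min lexx.
rewrite inE => /orP[/eqP->|/IH].
  have : m * (`|dotp e w| + 1) <= `|dotp c w|.
    by rewrite -ler_pdivlMr // ge_min lexx orbT.
  rewrite dotpDl dotpZl.
  have := ler_norm (dotp e w); have := ler_norm (- dotp e w); rewrite normrN.
  have [?|?] := ltrP 0 (dotp c w).
    rewrite (gtr0_norm (x := dotp c w)) // => h1 h2 h3; split=> [_|?]; last lra.
    nra.
  rewrite (ler0_norm (x := dotp c w)) // => h1 h2 h3; split=> [?|h4]; first lra.
  nra.
(* Shrinking the step is harmless: [c + m *: e] lies between [c] and [c + eps *: e], where the sign
   is already known. *)
rewrite !dotpDl !dotpZl => -[h1 h2]; split=> [/[dup] h3 /h1 h4|/[dup] h3 /h2 h4].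
  have [?|?] := ltrP 0 (dotp e v); nra.
have [?|?] := ltrP 0 (dotp e v); nra.
Qed.

(** Zeros are removed one vector at a time: where the functional vanishes on [w], a small multiple
    of [w] itself is added, and [dotp w w] is positive. *)
Lemma generic_perturbation (s : seq 'rV[R]_d) c : exists c', forall w, w \in s ->
  [/\ w != 0 -> dotp c' w != 0, 0 < dotp c w -> 0 < dotp c' w
    & dotp c w < 0 -> dotp c' w < 0].
Proof.
suff [c' [c's c'0]] : exists c', (forall w, w \in s ->
    (0 < dotp c w -> 0 < dotp c' w) /\ (dotp c w < 0 -> dotp c' w < 0)) /\
    (forall w, w \in s -> w != 0 -> dotp c' w != 0).
  by exists c' => w ws; have [? ?] := c's w ws; split=> //; exact: c'0.
have : {subset s <= s} by [].
(* The induction is on a sublist [t] on which zeros are gone, while nonzero signs are preserved on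
   all of [s]. *)
move: {1 4}s; elim=> [|w t IH] ts; first by exists c.
have [v vt|c' [c's c't]] := IH; first by apply: ts; rewrite inE vt orbT.
have [c'w|c'w] := eqVneq (dotp c' w) 0; last first.
  by exists c'; split=> // v; rewrite inE => /orP[/eqP->//|/c't].
have [eps e0 H] := small_shift s c' w.
exists (c' + eps *: w); split.
  by move=> v vs; have [? ?] := c's v vs; have [? ?] := H v vs; split; auto.
move=> v; rewrite inE => /orP[/eqP-> w0|vt v0].
  by rewrite dotpDl dotpZl c'w add0r mulf_neq0 ?gt_eqF ?dotp_gt0.
have [|H1 H2] := H v; first by apply: ts; rewrite inE vt orbT.
have := c't v vt v0; rewrite neq_lt => /orP[/H2|/H1]; rewrite neq_lt => ->//.
by rewrite orbT.
Qed.
End DotProduct.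

(** * Faces, vertices and edge graph of a zonotope *)

Section Zonotope.
Variables (R : realType) (d : nat) (I : finType) (g : I -> 'rV[R]_d).
Implicit Types (c x : 'rV[R]_d) (t : I -> R) (S : {set I}).

Definition zonotope : set 'rV[R]_d :=
  [set \sum_i t i *: g i | t in [set t : I -> R | forall i, 0 <= t i <= 1]].

Definition subsum S := \sum_(i in S) g i.
Definition positive_part c := [set i | 0 < dotp c (g i)]%SET.
Definition generic c := forall i, dotp c (g i) != 0.

Definition indicator S : I -> R := fun i => (i \in S)%:R.

Lemma indicator01 S i : 0 <= indicator S i <= 1.
Proof. by rewrite /indicator ler0n lern1 leq_b1. Qed.

Lemma subsumE S : subsum S = \sum_i indicator S i *: g i.
Proof.
rewrite /subsum big_mkcond; apply: eq_bigr => i _; rewrite /indicator.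
by case: (i \in S); rewrite ?scale1r ?scale0r.
Qed.

Lemma zonotope_subsum S : zonotope (subsum S).
Proof. by exists (indicator S) => [i|]; rewrite ?indicator01 ?subsumE. Qed.

(** Complementary slackness: the condition on coefficients for maximising [c]. Generators orthogonal
    to [c] keep a free coefficient. *)
Definition supports c t :=
  forall i, (0 < dotp c (g i) -> t i = 1) /\ (dotp c (g i) < 0 -> t i = 0).

(** For coefficients in the unit interval every summand is nonnegative, so a point attains the
    maximum exactly when each summand vanishes. *)
Lemma dotp_zonotope_gap c t :
  dotp c (subsum (positive_part c)) - dotp c (\sum_i t i *: g i) =
  \sum_i (indicator (positive_part c) i - t i) * dotp c (g i).
Proof.
rewrite subsumE !dotp_sumr -sumrB; apply: eq_bigr => i _.
by rewrite !dotpZr mulrBl.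
Qed.

Lemma gap_ge0 c t i : 0 <= t i <= 1 ->
  0 <= (indicator (positive_part c) i - t i) * dotp c (g i).
Proof.
move=> /andP[t0 t1]; rewrite /indicator inE; case: ltrP => h /=.
  by rewrite mulr_ge0 ?subr_ge0 // ltW.
by rewrite sub0r mulNr oppr_ge0 mulr_ge0_le0.
Qed.

Lemma dotp_zonotope_max c x : zonotope x ->
  dotp c x <= dotp c (subsum (positive_part c)).
Proof.
move=> [t t01 <-]; rewrite -subr_ge0 dotp_zonotope_gap.
by apply: sumr_ge0 => i _; exact: gap_ge0.
Qed.

Lemma dotp_zonotope_maxP c t : (forall i, 0 <= t i <= 1) ->
  dotp c (subsum (positive_part c)) <= dotp c (\sum_i t i *: g i) ->
  supports c t.
Proof.
move=> t01; rewrite -subr_le0 dotp_zonotope_gap => le0.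
have /psumr_eq0P s0 : \sum_i (indicator (positive_part c) i - t i) * dotp c (g i) = 0.
  by apply/eqP; rewrite eq_le le0 sumr_ge0 // => i _; exact: gap_ge0.
move=> i; have /eqP := s0 (fun i _ => gap_ge0 c (t01 i)) i isT.
rewrite /indicator inE mulf_eq0.
case: ltgtP => //= h; rewrite ?orbF ?orbT.
  by rewrite subr_eq0 => /eqP <-.
by rewrite sub0r oppr_eq0 => /eqP->.
Qed.

Lemma dotp_supports c t : supports c t ->
  dotp c (\sum_i t i *: g i) = dotp c (subsum (positive_part c)).
Proof.
move=> ct; apply/esym/eqP; rewrite -subr_eq0 dotp_zonotope_gap big1 // => i _.
have [h1 h2] := ct i; rewrite /indicator inE; case: ltgtP => h /=.
- by rewrite h1 // subrr mul0r.
- by rewrite h2 // subr0 mul0r.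
- by rewrite -h mulr0.
Qed.

Lemma face_zonotopeP c x : face zonotope c x <->
  exists t, [/\ forall i, 0 <= t i <= 1, x = \sum_i t i *: g i & supports c t].
Proof.
split.
  move=> [[t t01 <-] H]; exists t; split=> //; apply: dotp_zonotope_maxP => //.
  by apply: H; exact: zonotope_subsum.
move=> [t [t01 -> ct]]; split; first by exists t.
by move=> y; rewrite dotp_supports //; exact: dotp_zonotope_max.
Qed.

Lemma supports_generic c t : generic c -> supports c t ->
  forall i, t i = indicator (positive_part c) i.
Proof.
move=> gc ct i; have [h1 h2] := ct i; rewrite /indicator inE.
by have := gc i; case: ltgtP => //= h _; auto.
Qed.

Lemma supports_positive_part c : supports c (indicator (positive_part c)).
Proof. by move=> i; rewrite /indicator inE; case: ltgtP. Qed.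

Lemma face_generic c : generic c ->
  face zonotope c = [set subsum (positive_part c)].
Proof.
move=> gc; apply/seteqP; split=> x; rewrite face_zonotopeP.
  move=> [t [t01 -> ct]] /=; rewrite subsumE; apply: eq_bigr => i _.
  by rewrite (supports_generic gc ct).
move=> /= ->; exists (indicator (positive_part c)); split.
- by move=> i; exact: indicator01.
- exact: subsumE.
- exact: supports_positive_part.
Qed.

(** A point of a zonotope may have many coefficient vectors, but the maximiser of a generic
    functional has only one. Hence a vertex determines its sign pattern. *)
Lemma subsum_inj c S : generic c -> subsum S = subsum (positive_part c) ->
  S = positive_part c.
Proof.
move=> gc e.
have H : supports c (indicator S).
  apply: dotp_zonotope_maxP => [i|]; first exact: indicator01.
  by rewrite -subsumE e.
apply/setP => i; have /eqP := supports_generic gc H i.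
by rewrite /indicator eqr_nat; do 2!case: (_ \in _).
Qed.

Hypothesis g_indep : forall i j a b, i != j ->
  a *: g i + b *: g j = 0 -> a = 0 /\ b = 0.
Hypothesis g_neq0 : forall i, g i != 0.

(** Sliding along a generator orthogonal to [c] does not change the value of [c], so it stays inside
    the face. *)
Lemma face_shift c t i a : (forall i, 0 <= t i <= 1) -> supports c t ->
  dotp c (g i) = 0 -> 0 <= t i + a <= 1 ->
  face zonotope c (\sum_j t j *: g j + a *: g i).
Proof.
move=> t01 ct ci a01; apply/face_zonotopeP.
exists (fun j => if j == i then t i + a else t j); split.
- by move=> j; case: ifP.
- rewrite [RHS](bigD1 i) //= eqxx (bigD1 i) //= scalerDl addrAC; congr (_ + _).
  by apply: eq_bigr => j /negbTE ->.
- by move=> j; case: eqP => [->|_]; [rewrite ci ltxx|exact: ct].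
Qed.

(** If [c] were orthogonal to some [g i], giving [g i] the coefficients 0 and 1 would produce two
    distinct points of the face. *)
Lemma vertex_zonotopeP v : vertex zonotope v <->
  exists2 c, generic c & v = subsum (positive_part c).
Proof.
split=> [[c cv]|[c gc ->]]; last by exists c; exact: face_generic.
suff gc : generic c.
  by exists c => //; have : face zonotope c v by [rewrite cv]; rewrite face_generic.
move=> i; apply/negP => /eqP ci.
have ci' : i \notin positive_part c by rewrite inE ci ltxx.
have H0 := @face_shift c _ i 0 (indicator01 _) (@supports_positive_part c) ci.
have H1 := @face_shift c _ i 1 (indicator01 _) (@supports_positive_part c) ci.
move: H0 H1; rewrite /indicator (negbTE ci') !add0r cv !lexx ler01.
move=> /(_ isT) /= h0 /(_ isT) /= h1.
have /eqP := etrans h1 (esym h0).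
by rewrite scale0r addr0 -subr_eq0 addrC addKr scale1r (negbTE (g_neq0 i)).
Qed.

Lemma segmentE (u v : 'rV[R]_d) : segment u v = [set u + t *: (v - u) | t in `[0, 1]].
Proof.
by apply: eq_imagel => t _; rewrite scalerBl scale1r scalerBr addrA addrAC.
Qed.

Lemma segmentC (u v : 'rV[R]_d) : segment u v = segment v u.
Proof.
suff H : forall u' v' : 'rV[R]_d, segment u' v' `<=` segment v' u' by apply/seteqP; split; exact: H.
move=> {}u {}v x [t]; rewrite /= in_itv /= => /andP[t0 t1] <-.
exists (1 - t); first by rewrite /= in_itv /= subr_ge0 t1 lerBlDr lerDl t0.
by rewrite opprB [1 + _]addrC subrK addrC.
Qed.

(** Every generator orthogonal to [c] is parallel to the edge direction [v - u]; two different ones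
    would be linearly dependent. *)
Lemma edge_null_unique c u v i j : face zonotope c = segment u v ->
  dotp c (g i) = 0 -> dotp c (g j) = 0 -> i = j.
Proof.
move=> fc ci cj; apply/eqP/negP => /negP ij.
have null_seg k a : dotp c (g k) = 0 -> 0 <= a <= 1 -> exists b,
    subsum (positive_part c) + a *: g k = u + b *: (v - u).
  move=> ck a01.
  have kn : k \notin positive_part c by rewrite inE ck ltxx.
  have := @face_shift c _ k a (indicator01 _) (@supports_positive_part c) ck.
  rewrite {1 2}/indicator (negbTE kn) add0r -subsumE fc segmentE.
  by move=> /(_ a01) [b _ <-]; exists b.
have [||b0 h0] := null_seg i 0 => //; first by rewrite lexx ler01.
have [||bi hi] := null_seg i 1 => //; first by rewrite lexx ler01.
have [||bj hj] := null_seg j 1 => //; first by rewrite lexx ler01.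
move: h0 hi hj; rewrite scale0r addr0 => ->; rewrite !scale1r -!addrA.
move=> /addrI/(canRL (addKr _)); rewrite -scaleNr -scalerDl => hi.
move=> /addrI/(canRL (addKr _)); rewrite -scaleNr -scalerDl => hj.
have : (- b0 + bj) *: g i + (b0 - bi) *: g j = 0.
  rewrite hi hj !scalerA -scalerDl [X in X *: _](_ : _ = 0) ?scale0r //; ring.
move=> /(g_indep ij) [h1 h2].
by have := g_neq0 j; rewrite hj h1 scale0r eqxx.
Qed.

(** On sign patterns of generic functionals this is the graph distance of the vertices:
    [walk_set_dist] and [flip_walk] are the two inequalities. *)
Definition set_dist (S T : {set I}) := #|[set i | (i \in S) != (i \in T)]%SET|.

Lemma set_dist_triangle (S T U : {set I}) :
  (set_dist S U <= set_dist S T + set_dist T U)%N.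
Proof.
apply: leq_trans (leq_card_setU _ _); apply/subset_leq_card/fintype.subsetP => i.
by rewrite !inE; do 3!case: (_ \in _).
Qed.

(** Both endpoints lie in the face of [e], so a generator on which they disagree is orthogonal to
    [e], and at most one generator is. *)
Lemma adjacent_set_dist c c' : generic c -> generic c' ->
  Defs.adjacent zonotope (subsum (positive_part c)) (subsum (positive_part c')) ->
  (set_dist (positive_part c) (positive_part c') <= 1)%N.
Proof.
move=> gc gc' [_ _ _ [e fe]]; apply/card_le1_eqP => i j.
have in_face S : segment (subsum (positive_part c)) (subsum (positive_part c'))
    (subsum S) -> supports e (indicator S).
  rewrite -fe => -[_ /(_ (subsum (positive_part e)))].
  move/(_ (@zonotope_subsum _)); rewrite [subsum S]subsumE.
  by apply: dotp_zonotope_maxP => i'; exact: indicator01.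
have h1 : supports e (indicator (positive_part c)).
  apply: in_face; rewrite segmentE; exists 0; rewrite ?scale0r ?addr0 //.
  by rewrite /= in_itv /= lexx ler01.
have h2 : supports e (indicator (positive_part c')).
  apply: in_face; rewrite segmentE; exists 1; last by rewrite scale1r addrC subrK.
  by rewrite /= in_itv /= lexx ler01.
have null k : (k \in positive_part c) != (k \in positive_part c') ->
    dotp e (g k) = 0.
  have [p1 n1] := h1 k; have [p2 n2] := h2 k.
  case: (ltgtP (dotp e (g k)) 0) => // h.
    have := etrans (n1 h) (esym (n2 h)).
    by rewrite /indicator => /eqP; rewrite eqr_nat; do 2!case: (_ \in _).
  have := etrans (p1 h) (esym (p2 h)).
  by rewrite /indicator => /eqP; rewrite eqr_nat; do 2!case: (_ \in _).
rewrite finset.in_set => /null ni; rewrite finset.in_set => /null nj.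
exact: (edge_null_unique fe nj ni).
Qed.

Lemma walk_set_dist n c c' : generic c -> generic c' ->
  walk (Defs.adjacent zonotope) n (subsum (positive_part c))
    (subsum (positive_part c')) ->
  (set_dist (positive_part c) (positive_part c') <= n)%N.
Proof.
move=> gc gc' [s [<- ps ls]] {n}.
elim: s c gc ps ls => [|v s IH] c gc /=.
  move=> _ e; rewrite (subsum_inj gc' e) leqn0 cards_eq0.
  by apply/eqP/setP => i; rewrite !inE eqxx.
move=> /andP[/asboolP cv ps] ls; have [_ vv _ _] := cv.
have /vertex_zonotopeP [e ge ve] := vv; subst v.
apply: leq_trans (set_dist_triangle _ (positive_part e) _) _.
by rewrite -add1n leq_add ?IH //; exact: adjacent_set_dist.
Qed.

(** The coefficient of [g i] is the only one that [supports] leaves free. *)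
Lemma edge_face c i : dotp c (g i) = 0 ->
  (forall j, dotp c (g j) = 0 -> j = i) ->
  face zonotope c =
    segment (subsum (positive_part c)) (subsum (i |: positive_part c)%SET).
Proof.
move=> ci ui; have kn : i \notin positive_part c by rewrite inE ci ltxx.
rewrite segmentE {2}/subsum big_setU1 //= -/(subsum _) addrK.
apply/seteqP; split=> x.
  move=> /face_zonotopeP [t [t01 -> ct]]; exists (t i).
    by rewrite /= in_itv /=.
  rewrite subsumE (bigD1 i) // [RHS](bigD1 i) //=.
  rewrite {1}/indicator (negbTE kn) scale0r add0r addrC; congr (_ + _).
  apply: eq_bigr => j ji; congr (_ *: _).
  have [h1 h2] := ct j; rewrite /indicator inE.
  case: ltgtP => // h; first by rewrite h1.
  - by rewrite h2.
  - by move/eqP: ji; case; exact/ui.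
move=> [a]; rewrite /= in_itv /= => a01 <-; rewrite subsumE.
apply: face_shift => //; first by move=> j; exact: indicator01.
  exact: supports_positive_part.
by rewrite /indicator (negbTE kn) add0r.
Qed.

(** Here [c] lies on the hyperplane orthogonal to [g i], with [c1] and [c3] on either side. Both
    orders are recorded because a flip may insert or remove [i]. *)
Lemma flip_adjacent c c1 c3 i : generic c1 -> generic c3 ->
  dotp c (g i) = 0 -> (forall j, dotp c (g j) = 0 -> j = i) ->
  positive_part c1 = positive_part c ->
  positive_part c3 = (i |: positive_part c)%SET ->
  Defs.adjacent zonotope (subsum (positive_part c1)) (subsum (positive_part c3)) /\
  Defs.adjacent zonotope (subsum (positive_part c3)) (subsum (positive_part c1)).
Proof.
move=> g1 g3 ci ui p1 p3.
have kn : i \notin positive_part c by rewrite inE ci ltxx.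
have v1 : vertex zonotope (subsum (positive_part c1)).
  by apply/vertex_zonotopeP; exists c1.
have v3 : vertex zonotope (subsum (positive_part c3)).
  by apply/vertex_zonotopeP; exists c3.
have n13 : subsum (positive_part c1) <> subsum (positive_part c3).
  by move=> /(subsum_inj g3); rewrite p1 p3 => e; move: kn; rewrite e setU11.
have f13 := edge_face ci ui; rewrite -p3 -p1 in f13.
split; split=> //; first by exists c.
  by move=> /esym.
by exists c; rewrite segmentC.
Qed.

(* The first hyperplane crossed when moving from [c] to [c'] is unique once [c]
   is generic with respect to the vectors
   [dotp c' (g j) *: g i - dotp c' (g i) *: g j]. *)
Lemma flip_step c c' : generic c -> generic c' ->
  positive_part c != positive_part c' -> exists2 c3, generic c3 &
  Defs.adjacent zonotope (subsum (positive_part c)) (subsum (positive_part c3)) /\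
  (set_dist (positive_part c) (positive_part c') =
    (set_dist (positive_part c3) (positive_part c')).+1)%N.
Proof.
move=> gc gc' ne.
pose W (ij : I * I) := dotp c' (g ij.2) *: g ij.1 - dotp c' (g ij.1) *: g ij.2.
have [c1 Hc1] := generic_perturbation (codom g ++ codom W) c.
have signc1 i : (0 < dotp c (g i) -> 0 < dotp c1 (g i)) /\
    (dotp c (g i) < 0 -> dotp c1 (g i) < 0).
  by have [|_ ? ?] := Hc1 (g i); rewrite ?mem_cat ?codom_f.
have gc1 : generic c1.
  by move=> i; have [|-> ] := Hc1 (g i); rewrite ?mem_cat ?codom_f.
have pc1 : positive_part c1 = positive_part c.
  apply/setP => i; rewrite !inE; have [h1 h2] := signc1 i.
  have := gc i; rewrite neq_lt => /orP[h|h].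
    by rewrite [RHS]ltNge (ltW h) ltNge (ltW (h2 h)).
  by rewrite h h1.
have Wc1 i j : i != j ->
    dotp c' (g j) * dotp c1 (g i) != dotp c' (g i) * dotp c1 (g j).
  move=> ij; have [|H _ _] := Hc1 (W (i, j)); first by rewrite mem_cat codom_f orbT.
  move: H; rewrite /W /= dotpDr -scaleNr !dotpZr mulNr subr_eq0; apply.
  apply/eqP => /(g_indep ij) [h _].
  by have := gc' j; rewrite h eqxx.
rewrite -pc1 in ne *; move: ne => {c gc Hc1 signc1 pc1} ne.
pose D i := (i \in positive_part c1) != (i \in positive_part c').
(* The time at which the segment from [c1] to [c'] crosses the hyperplane orthogonal to [g i], for
   the generators in [D], which change sign. *)
pose tau i := dotp c1 (g i) / (dotp c1 (g i) - dotp c' (g i)).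
have [i1 Di1] : exists i, D i.
  apply/existsP; move: ne; apply: contraR; rewrite negb_exists => /forallP H.
  by apply/eqP/setP => i; apply/eqP; have := H i; rewrite /D negbK.
have DE i : D i = (dotp c1 (g i) * dotp c' (g i) < 0).
  rewrite /D !inE; have := gc1 i; have := gc' i; rewrite !neq_lt.
  move=> /orP[h1|h1] /orP[h2|h2].
  - by rewrite [0 < dotp c1 _]ltNge (ltW h2) [0 < dotp c' _]ltNge (ltW h1) /= [RHS]ltNge mulr_le0 // ltW.
  - by rewrite h2 [0 < dotp c' _]ltNge (ltW h1) /= pmulr_rlt0.
  - by rewrite h1 [0 < dotp c1 _]ltNge (ltW h2) /= pmulr_llt0.
  - by rewrite h1 h2 /= [RHS]ltNge mulr_ge0 // ltW.
case: (@arg_minP _ R I i1 D tau Di1) => i Di min.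
have ab : dotp c1 (g i) * dotp c' (g i) < 0 by rewrite -DE.
have abn : dotp c1 (g i) - dotp c' (g i) != 0.
  by apply/eqP => h; move: ab; rewrite (_ : dotp c' _ = dotp c1 (g i)) -?expr2 ?ltNge ?sqr_ge0 //; lra.
set t := tau i in min.
have tE : t * (dotp c1 (g i) - dotp c' (g i)) = dotp c1 (g i) by rewrite /t /tau divfK.
have t01 : 0 < t < 1.
  have := gc1 i; rewrite neq_lt => /orP[h|h].
    have h' : 0 < dotp c' (g i) by rewrite nmulr_rlt0 in ab.
    by apply/andP; split; nra.
  have h' : dotp c' (g i) < 0 by rewrite pmulr_rlt0 in ab.
  by apply/andP; split; nra.
move/andP: t01 => [t0 t1].
(* The functional at the first crossing time; there [g i] is the only generator with value zero. *)
pose c2 := c1 + t *: (c' - c1).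
have c2E j : dotp c2 (g j) = (1 - t) * dotp c1 (g j) + t * dotp c' (g j).
  by rewrite /c2 dotpDl dotpZl dotpDl -scaleN1r dotpZl; ring.
have c2i : dotp c2 (g i) = 0 by rewrite c2E; lra.
have sign2 j : j != i -> 0 < dotp c2 (g j) * dotp c1 (g j).
  move=> ji; rewrite c2E.
  case Dj: (D j); last first.
    have h : 0 < dotp c1 (g j) * dotp c' (g j).
      by rewrite lt_neqAle leNgt -DE Dj eq_sym mulf_neq0 ?gc1 ?gc'.
    have := sqr_ge0 (dotp c1 (g j)); rewrite expr2 => h2; nra.
  have := Dj; rewrite DE => abj.
  have sq : 0 < dotp c1 (g j) * (dotp c1 (g j) - dotp c' (g j)).
    by have := sqr_ge0 (dotp c1 (g j)); rewrite expr2 => h2; nra.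
  have abjn : dotp c1 (g j) - dotp c' (g j) != 0.
    by apply/eqP => h; move: sq; rewrite h mulr0 ltxx.
  have tj : tau j * (dotp c1 (g j) - dotp c' (g j)) = dotp c1 (g j).
    by rewrite /tau divfK.
  have ttj : t < tau j.
    rewrite lt_neqAle min // andbT; apply/eqP => e.
    (* Simultaneous crossings of [g i] and [g j] would give the equality excluded by [Wc1]. *)
    have := Wc1 _ _ ji; rewrite -{}e in tj; case/eqP.
    have t1n : 1 - t != 0 by rewrite subr_eq0 gt_eqF.
    apply: (mulfI t1n).
    have e1 : (1 - t) * dotp c1 (g i) = - t * dotp c' (g i) by lra.
    have e2 : (1 - t) * dotp c1 (g j) = - t * dotp c' (g j) by lra.
    by rewrite mulrCA e2 [RHS]mulrCA e1; ring.
  have -> : ((1 - t) * dotp c1 (g j) + t * dotp c' (g j)) * dotp c1 (g j) =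
      (tau j - t) * (dotp c1 (g j) * (dotp c1 (g j) - dotp c' (g j))).
    by rewrite [RHS]mulrBl [tau j * _]mulrCA tj; ring.
  by rewrite mulr_gt0 // subr_gt0.
have [eps e0 Heps] := small_shift (codom g) c2 c'.
(* Just past the crossing: [g i] takes its sign under [c'], all other signs are as under [c1]. *)
pose c3 := c2 + eps *: c'.
have sign3 j : j != i -> 0 < dotp c3 (g j) * dotp c1 (g j).
  move=> ji; have [h1 h2] := Heps (g j) (codom_f _ _); have := sign2 j ji.
  have := gc1 j; rewrite neq_lt => /orP[h|h].
    by rewrite !nmulr_lgt0 //; exact: h2.
  by rewrite !pmulr_lgt0 //; exact: h1.
have c3i : dotp c3 (g i) = eps * dotp c' (g i) by rewrite dotpDl dotpZl c2i add0r.
have gc3 : generic c3.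
  move=> j; have [->|ji] := eqVneq j i; first by rewrite c3i mulf_neq0 ?gc' // gt_eqF.
  by apply/eqP => h; have := sign3 j ji; rewrite h mul0r ltxx.
have uniq2 j : dotp c2 (g j) = 0 -> j = i.
  by move=> h; apply/eqP/negPn/negP => /sign2; rewrite h mul0r ltxx.
have same_sign (a b : R) : 0 < a * b -> (0 < a) = (0 < b).
  have [a0|a0|->] := ltrgt0P a; last by rewrite mul0r ltxx.
    by rewrite pmulr_rgt0.
  by rewrite nmulr_rgt0 // => b0; rewrite [RHS]ltNge (ltW b0).
have in2 j : j != i -> (j \in positive_part c2) = (j \in positive_part c1).
  by move=> ji; rewrite !inE; exact/same_sign/sign2.
have in3 j : j != i -> (j \in positive_part c3) = (j \in positive_part c1).
  by move=> ji; rewrite !inE; exact/same_sign/sign3.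
have i2 : i \in positive_part c2 = false by rewrite inE c2i ltxx.
have i3 : (i \in positive_part c3) = (i \in positive_part c').
  by rewrite !inE c3i pmulr_rgt0.
have i13 : (i \in positive_part c3) = ~~ (i \in positive_part c1).
  by move: Di; rewrite /D i3; do 2!case: (_ \in _).
exists c3 => //; split; last first.
  rewrite /set_dist (cardsD1 i) inE -/(D i) Di add1n; congr _.+1.
  apply: eq_card => j; rewrite finset.in_setD1 finset.in_set [in RHS]finset.in_set.
  by have [->|ji] := eqVneq j i; [rewrite i3 eqxx|rewrite in3].
(* The positive part at [c2] omits [i], so it agrees with that of [c3] if [i] leaves and with that
   of [c1] if [i] enters. *)
case i1E : (i \in positive_part c1).
  have [] := @flip_adjacent c2 c3 c1 i => //.
  - apply/setP => j; have [->|ji] := eqVneq j i; first by rewrite i2 i13 i1E.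
    by rewrite in2 // in3.
  - apply/setP => j; rewrite finset.in_setU1.
    by have [->|ji] := eqVneq j i; [rewrite i1E|rewrite in2].
have [] := @flip_adjacent c2 c1 c3 i => //.
- apply/setP => j; have [->|ji] := eqVneq j i; first by rewrite i2 i1E.
  by rewrite in2.
- apply/setP => j; rewrite finset.in_setU1.
  by have [->|ji] := eqVneq j i; [rewrite i13 i1E|rewrite in2 // in3].
Qed.

Lemma flip_walk c c' : generic c -> generic c' ->
  walk (Defs.adjacent zonotope) (set_dist (positive_part c) (positive_part c'))
    (subsum (positive_part c)) (subsum (positive_part c')).
Proof.
move=> gc gc'; move en : (set_dist _ _) => n.
elim: n c gc en => [|n IH] c gc en.
  exists [::]; split=> //=; congr subsum; apply/setP => i.
  by move/cards0_eq/setP/(_ i): en; rewrite !inE => /negbFE/eqP.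
have [|c3 gc3 [adj]] := @flip_step c c' gc gc'.
  apply: contra_eqN en => /eqP ->; rewrite /set_dist.
  by rewrite (_ : [set _ | _]%SET = finset.set0) ?cards0 //; apply/setP => i; rewrite !inE eqxx.
rewrite en => -[/esym] /(IH c3 gc3) [s [ss ps ls]].
exists (subsum (positive_part c3) :: s); split=> //=; first by rewrite ss.
by rewrite ps andbT; exact/asboolP.
Qed.

Theorem zonotope_diameter : Defs.diameter zonotope = (#|I|%:R)%:E.
Proof.
apply/eqP; rewrite eq_le; apply/andP; split.
  apply: ge_ereal_sup => _ [[u v] /= [+ +] <-].
  move=> /vertex_zonotopeP [c gc ->] /vertex_zonotopeP [c' gc' ->].
  apply: (@le_trans _ _ ((set_dist (positive_part c) (positive_part c'))%:R)%:E).
    by apply: ereal_inf_lbound; exists (set_dist (positive_part c) (positive_part c')) => //; exact: flip_walk.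
  by rewrite lee_fin ler_nat max_card.
have [c Hc] := generic_perturbation (codom g) 0.
have gc : generic c by move=> i; have [|->] := Hc (g i); rewrite ?codom_f.
have gc' : generic (- c).
  by move=> i; rewrite -scaleN1r dotpZl mulf_neq0 ?gc // oppr_eq0 oner_eq0.
apply: (@le_trans _ _ (graph_dist R (Defs.adjacent zonotope)
    (subsum (positive_part c)) (subsum (positive_part (- c))))); last first.
  apply: ereal_sup_ubound.
  exists (subsum (positive_part c), subsum (positive_part (- c))) => //.
  by split; apply/vertex_zonotopeP; [exists c|exists (- c)].
apply: le_ereal_inf_tmp => _ [n /= w <-]; rewrite lee_fin ler_nat.
apply: leq_trans (walk_set_dist gc gc' w).
rewrite /set_dist (_ : [set _ | _]%SET = [set: I]%SET) ?cardsT //.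
apply/setP => i; rewrite !inE -scaleN1r dotpZl mulN1r oppr_gt0.
by have := gc i; case: ltgtP.
Qed.

End Zonotope.

(** * Primitive points and lattice balls *)

Section PrimitivePoints.
Variable d : nat.
Implicit Types (x y : 'rV[int]_d).

Definition coord_gcd x : nat := \big[gcdn/0%N]_(i < d) absz (x 0 i).

Lemma coord_gcdZ (c : int) x : coord_gcd (c *: x) = (absz c * coord_gcd x)%N.
Proof.
rewrite /coord_gcd (big_morph (muln (absz c)) (muln_gcdr (absz c)) (muln0 _)).
by apply: eq_bigr => i _; rewrite mxE abszM.
Qed.

Lemma coord_gcd_eq0 x : (coord_gcd x == 0%N) = (x == 0).
Proof.
apply/eqP/eqP => [x0|->]; last first.
  by apply: big1 => i _; rewrite mxE.
apply/rowP => i; rewrite mxE; apply/eqP; rewrite -absz_eq0.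
have : (coord_gcd x %| absz (x 0%R i))%N by apply: (biggcdn_inf i).
by rewrite x0 dvd0n.
Qed.

Lemma primitive_pointE x : primitive_point x <-> coord_gcd x = 1%N.
Proof.
split=> [[]//|x1]; split=> //; apply/eqP; rewrite -coord_gcd_eq0.
by rewrite /coord_gcd in x1 *; rewrite x1.
Qed.

(** The vanishing minors say that [x 0 i *: y = y 0 i *: x]; compare the gcds of both sides. *)
Lemma abs_eq_of_minors x y : coord_gcd x = 1%N -> coord_gcd y = 1%N ->
  (forall i j, x 0 i * y 0 j = x 0 j * y 0 i) ->
  forall i, absz (x 0 i) = absz (y 0 i).
Proof.
move=> x1 y1 xy i.
transitivity (coord_gcd (x 0 i *: y)); first by rewrite coord_gcdZ y1 muln1.
rewrite (_ : x 0 i *: y = y 0 i *: x) ?coord_gcdZ ?x1 ?muln1 //.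
by apply/rowP => j; rewrite !mxE [RHS]mulrC.
Qed.

(** Equal absolute values put the first nonzero coordinates at the same index. They are equal there
    by positivity, so the proportionality factor is 1. *)
Lemma eq_of_minors x y : coord_gcd x = 1%N -> coord_gcd y = 1%N ->
  first_nonzero_pos x -> first_nonzero_pos y ->
  (forall i j, x 0 i * y 0 j = x 0 j * y 0 i) -> x = y.
Proof.
move=> x1 y1 [ix xi xlt] [iy yi ylt] xy.
have axy := abs_eq_of_minors x1 y1 xy.
have e : ix = iy.
  apply/val_inj; case: (ltngtP ix iy) => // h.
    by have := axy ix; rewrite (ylt _ h); lia.
  by have := axy iy; rewrite (xlt _ h); lia.
subst iy; apply/rowP => j.
have xyi : x 0 ix = y 0 ix by have := axy ix; lia.
have := xy j ix; rewrite xyi [RHS]mulrC => /mulIf; apply.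
by rewrite gt_eqF.
Qed.

(** A nontrivial real relation forces all two by two minors to vanish, which [eq_of_minors] excludes
    for distinct points. *)
Lemma primitive_independent (R : realType) x y (a b : R) :
  coord_gcd x = 1%N -> coord_gcd y = 1%N ->
  first_nonzero_pos x -> first_nonzero_pos y -> x != y ->
  a *: toR R x + b *: toR R y = 0 -> a = 0 /\ b = 0.
Proof.
move=> x1 y1 px py nxy /rowP E.
have {}E i : a * (x 0 i)%:~R + b * (y 0 i)%:~R = 0 by have := E i; rewrite !mxE.
have [ab|] := boolP ((a == 0) && (b == 0)).
  by move/andP: ab => [/eqP -> /eqP ->].
rewrite negb_and => ab; case/eqP: nxy; apply: eq_of_minors => // i j.
apply/eqP; rewrite -(eqr_int R) !intrM; apply/eqP.
have Ei := E i; have Ej := E j.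
case/orP: ab => [/mulfI|/mulfI]; apply.
  transitivity (- (b * (y 0 i)%:~R) * (y 0 j)%:~R).
    by rewrite mulrA; congr (_ * _); apply/eqP; rewrite -addr_eq0 Ei.
  rewrite [RHS]mulrA.
  by rewrite (_ : a * (x 0 j)%:~R = - (b * (y 0 j)%:~R)); [ring|apply/eqP; rewrite -addr_eq0 Ej].
rewrite mulrCA (_ : b * (y 0 j)%:~R = - (a * (x 0 j)%:~R)); last first.
  by apply/eqP; rewrite -addr_eq0 addrC Ej.
rewrite [RHS]mulrCA (_ : b * (y 0 i)%:~R = - (a * (x 0 i)%:~R)); last first.
  by apply/eqP; rewrite -addr_eq0 addrC Ei.
by ring.
Qed.

(** Encodes each nonzero integer exactly once, by its sign and its absolute value less one. *)
Definition signed_multiple (s : bool) (k : nat) : int := (-1) ^+ s * k.+1%:Z.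

Lemma signed_multiple_neq0 s k : signed_multiple s k != 0.
Proof. by rewrite /signed_multiple mulf_neq0 // expf_neq0. Qed.

Lemma abs_signed_multiple s k : absz (signed_multiple s k) = k.+1.
Proof. by rewrite /signed_multiple abszM abszX exp1n mul1n. Qed.

Lemma first_nonzero_neq0 x : first_nonzero_pos x -> x != 0.
Proof. by move=> [i + _]; apply: contraTneq => ->; rewrite mxE ltxx. Qed.

(** With [signed_multiple_ex], a nonzero lattice point is in exactly one way a nonzero multiple of a
    primitive point whose first nonzero coordinate is positive. *)
Lemma signed_multiple_inj s s' k k' x y :
  coord_gcd x = 1%N -> coord_gcd y = 1%N ->
  first_nonzero_pos x -> first_nonzero_pos y ->
  signed_multiple s k *: x = signed_multiple s' k' *: y ->
  [/\ s = s', k = k' & x = y].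
Proof.
move=> x1 y1 px py E.
have ek : k = k'.
  have := congr1 coord_gcd E.
  by rewrite !coord_gcdZ !abs_signed_multiple x1 y1 !muln1 => -[].
have exy : x = y.
  apply: eq_of_minors => // i j.
  apply: (mulfI (signed_multiple_neq0 s k)); apply: (mulfI (signed_multiple_neq0 s' k')).
  have /rowP E' := E; have Ei := E' i; have Ej := E' j; rewrite !mxE in Ei Ej.
  rewrite [_ * (x 0 i * _)]mulrA Ei [_ * (x 0 j * _)]mulrA Ej; ring.
subst y k'; split=> //.
have [i xi _] := px; move/rowP/(_ i): E; rewrite !mxE.
move/(mulIf (lt0r_neq0 xi)); rewrite /signed_multiple => /mulIf.
by move=> /(_ isT); case: s; case: s'; rewrite ?expr0 ?expr1.
Qed.

(** Divide by the gcd of the coordinates and by the sign of the first nonzero one. *)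
Lemma signed_multiple_ex x : x != 0 -> exists s k y,
  [/\ coord_gcd y = 1%N, first_nonzero_pos y & x = signed_multiple s k *: y].
Proof.
move=> x0.
have [j xj] : exists j, x 0 j != 0.
  by apply/rV0Pn.
case: (@arg_minnP _ j (fun i => x 0 i != 0) (fun i : 'I_d => val i) xj) => i xi imin.
have dvdx l : (coord_gcd x %| absz (x 0%R l))%N by apply: (biggcdn_inf l).
pose s := x 0 i < 0.
have c0 : (0 < coord_gcd x)%N by rewrite lt0n coord_gcd_eq0.
pose k := (coord_gcd x).-1.
have kE : k.+1 = coord_gcd x by rewrite prednK.
pose y : 'rV[int]_d := \row_l ((-1) ^+ s * (x 0%R l %/ (coord_gcd x)%:Z)%Z).
have xE : x = signed_multiple s k *: y.
  apply/rowP => l; rewrite !mxE /signed_multiple kE mulrACA.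
  rewrite -expr2 sqrr_sign mul1r mulrC divzK //.
  by rewrite dvdzE /=.
exists s, k, y; split=> //.
  apply/eqP; rewrite -(eqn_pmul2l c0) muln1 -[X in (X * _)%N]kE.
  by rewrite -(abs_signed_multiple s) -coord_gcdZ -xE.
have sx l : signed_multiple s k * y 0 l = x 0 l by move/rowP/(_ l): (xE); rewrite mxE => <-.
exists i.
  have : 0 < ((-1) ^+ s * x 0 i : int).
    rewrite /s; move: xi; rewrite neq_lt => /orP[h|h].
      by rewrite h expr1 mulN1r oppr_gt0.
    by rewrite [x 0 i < 0]ltNge (ltW h) expr0 mul1r.
  rewrite -[x 0 i]sx /signed_multiple mulrA mulrA -expr2 sqrr_sign.
  by rewrite mul1r pmulr_rgt0.
move=> l li; apply: (mulfI (signed_multiple_neq0 s k)); rewrite sx mulr0.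
apply/eqP/negPn/negP => /imin; by rewrite leqNgt li.
Qed.

End PrimitivePoints.

(** * Lattice points in cubes *)

Section Boxes.
Variable d : nat.
Implicit Types x : 'rV[int]_d.

Definition box_point n (f : {ffun 'I_d -> 'I_(n.*2.+1)}) : 'rV[int]_d :=
  \row_i ((f i)%:Z - n%:Z).

Lemma box_point_inj n : injective (@box_point n).
Proof.
move=> f g /rowP E; apply/ffunP => i; have := E i; rewrite !mxE => /addIr [].
by move=> /ord_inj.
Qed.

Lemma box_point_surj n x : (forall i, absz (x 0%R i) <= n)%N ->
  exists f, x = box_point (n := n) f.
Proof.
move=> xn; exists [ffun i => inord (absz (x 0 i + n%:Z))].
apply/rowP => i; rewrite mxE ffunE inordK; have := xn i; lia.
Qed.

Lemma box_point_bound n f i : (absz (box_point (n := n) f 0%R i) <= n)%N.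
Proof. by rewrite mxE; have := ltn_ord (f i); lia. Qed.

Lemma finite_bounded (A : set 'rV[int]_d) n :
  (forall x, A x -> forall i, (absz (x 0%R i) <= n)%N) -> finite_set A.
Proof.
move=> An; apply: (@sub_finite_set _ _ (range (@box_point n))).
  by move=> x /An /box_point_surj [f ->]; exists f.
exact/finite_image/finite_finset.
Qed.

End Boxes.

(** * Counting lattice points and generators by norm *)

Section LatticeCount.
Variables (R : realType) (q : R) (hq : 1 <= q) (d : nat).
Implicit Types (x y : 'rV[int]_d) (p : R).

Let q0 : 0 < q. Proof. by rewrite (lt_le_trans ltr01). Qed.

Definition qsum x : R := \sum_(i < d) `|(x 0 i)%:~R| `^ q.

Lemma qsum_ge0 x : 0 <= qsum x.
Proof. by apply: sumr_ge0 => i _; rewrite powR_ge0. Qed.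

Lemma qnormE x : qnorm q (toR R x) = qsum x `^ q^-1.
Proof. by congr (_ `^ _); apply: eq_bigr => i _; rewrite mxE. Qed.

Lemma powRVK (a : R) : 0 <= a -> (a `^ q^-1) `^ q = a.
Proof. by move=> a0; rewrite -powRrM mulVf ?gt_eqF // powRr1. Qed.

Lemma powRKV (a : R) : 0 <= a -> (a `^ q) `^ q^-1 = a.
Proof. by move=> a0; rewrite -powRrM mulfV ?gt_eqF // powRr1. Qed.

Lemma qnorm_le x p : 0 <= p -> (qnorm q (toR R x) <= p) = (qsum x <= p `^ q).
Proof.
move=> p0; rewrite qnormE; apply/idP/idP => h.
  rewrite -[qsum x]powRVK ?qsum_ge0 //.
  by apply: ge0_ler_powR; rewrite ?nnegrE ?powR_ge0 // ltW.
rewrite -[p]powRKV //.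
by apply: ge0_ler_powR; rewrite ?nnegrE ?powR_ge0 ?qsum_ge0 ?invr_ge0 // ltW.
Qed.

Lemma natr_abszR (c : int) : (absz c)%:R = `|c%:~R| :> R.
Proof. by rewrite natr_absz intr_norm. Qed.

Lemma qnormZ (c : int) x : qnorm q (toR R (c *: x)) = (absz c)%:R * qnorm q (toR R x).
Proof.
rewrite !qnormE.
have -> : qsum (c *: x) = ((absz c)%:R `^ q) * qsum x.
  rewrite mulr_sumr; apply: eq_bigr => i _; rewrite mxE intrM normrM powRM //.
  by rewrite natr_abszR.
by rewrite powRM ?powR_ge0 ?qsum_ge0 // powRKV.
Qed.

Lemma abs_le_qnorm x i : (absz (x 0 i))%:R <= qnorm q (toR R x).
Proof.
rewrite qnormE -[leLHS]powRKV //; apply: ge0_ler_powR.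
- by rewrite invr_ge0 ltW.
- by rewrite nnegrE powR_ge0.
- by rewrite nnegrE qsum_ge0.
rewrite natr_abszR /qsum (bigD1 i) //= lerDl.
by apply: sumr_ge0 => j _; rewrite powR_ge0.
Qed.

Definition lattice_ball p : set 'rV[int]_d := [set x | qnorm q (toR R x) <= p].

Lemma lattice_ball_bound p n : p <= n%:R -> forall x, lattice_ball p x ->
  forall i, (absz (x 0%R i) <= n)%N.
Proof.
move=> pn x xp i; rewrite -(ler_nat R).
by apply: le_trans (abs_le_qnorm x i) (le_trans xp pn).
Qed.

Lemma finite_lattice_ball p : finite_set (lattice_ball p).
Proof.
apply: (@finite_bounded d _ (Num.trunc p).+1).
by apply: lattice_ball_bound; exact/ltW/truncnS_gt.
Qed.

Lemma finite_generators p : finite_set (@generators R q d p).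
Proof. by apply: sub_finite_set (finite_lattice_ball p) => x []. Qed.

Definition ball_count p : nat := #|` fset_set (lattice_ball p)|.
Definition generator_count p : nat := #|` fset_set (@generators R q d p)|.

(** Nonzero points of the ball are the [signed_multiple s k *: y] with [y] a generator of norm at
    most [p / k.+1]; the factor 2 is the sign and the successor is the origin. Stopping at [M] loses
    nothing, since generators have norm at least 1. *)
Lemma ball_countE p M : 0 <= p -> p <= M%:R ->
  ball_count p = (2 * \sum_(k < M) generator_count (p / k.+1%:R)).+1.
Proof.
move=> p0 pM.
pose G (k : nat) := fset_set (@generators R q d (p / k.+1%:R)).
pose T := {ks : 'I_M * bool & G ks.1}.
pose F (u : T) : 'rV[int]_d :=
  signed_multiple (tag u).2 (tag u).1 *: val (tagged u).
have GP k (y : G k) : [/\ coord_gcd (val y) = 1%N, qnorm q (toR R (val y)) <= p / k.+1%:R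
    & first_nonzero_pos (val y)].
  have := valP y; rewrite in_fset_set ?inE; last exact: finite_generators.
  by move=> [/primitive_pointE].
have Finj : injective F.
  move=> [[k s] y] [[k' s'] y'] /signed_multiple_inj; rewrite /=.
  have [y1 _ y2] := GP k y; have [y1' _ y2'] := GP k' y'.
  move=> /(_ y1 y1' y2 y2') [? /val_inj ? e]; subst k' s'.
  by congr existT; exact: val_inj.
have mem x : (x \in fset_set (lattice_ball p)) = (qnorm q (toR R x) <= p).
  by rewrite in_fset_set ?inE //; [apply/asboolP/idP|exact: finite_lattice_ball].
have P : perm_eq (fset_set (lattice_ball p)) (0 :: codom F).
  apply: uniq_perm; first exact: fset_uniq.
    rewrite /= map_inj_uniq ?enum_uniq // andbT; apply/codomP => -[[[k s] y]].
    have [_ _ /first_nonzero_neq0 y0] := GP k y.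
    by rewrite /F /= => /esym/eqP; rewrite -coord_gcd_eq0 coord_gcdZ muln_eq0 coord_gcd_eq0 (negbTE y0) orbF abs_signed_multiple.
  move=> x; rewrite inE mem; apply/idP/idP => [xp|/orP[/eqP ->|/codomP [[[k s] y] ->]]].
  - have [//|x0] := eqVneq x 0; rewrite /=.
    have [s [k [y [y1 y2 xE]]]] := signed_multiple_ex x0.
    rewrite xE qnormZ abs_signed_multiple mulrC -ler_pdivlMr // in xp.
    have kM : (k < M)%N.
      have [i yi _] := y2; have := le_trans (abs_le_qnorm y i) xp.
      rewrite ler_pdivlMr // -natrM => /le_trans /(_ pM); rewrite ler_nat.
      by apply: leq_trans; rewrite -[X in (X <= _)%N]mul1n leq_mul //; lia.
    have yG : y \in G (Ordinal kM).
      rewrite in_fset_set; last exact: finite_generators.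
      by rewrite inE; split=> //; apply/primitive_pointE.
    apply/codomP; exists (Tagged (fun ks : 'I_M * bool => G ks.1) (i := (Ordinal kM, s)) [` yG]%fset).
    by rewrite /F /= xE.
  - by rewrite -(scale0r 0) qnormZ mul0r.
  - have [_ yp _] := GP k y.
    by rewrite /F /= qnormZ abs_signed_multiple mulrC -ler_pdivlMr.
have := perm_size P; rewrite /ball_count /= size_codom card_tagged sumnE big_map enumT => ->.
congr _.+1; rewrite big_distrr /=.
rewrite -(pair_bigA _ (fun (k : 'I_M) (s : bool) => #|{: G k}|)) /=.
apply: eq_bigr => k _; rewrite big_const card_bool /= addn0 addnn mul2n.
by rewrite /generator_count cardfE.
Qed.

End LatticeCount.


(** * Existence of the volume limit *)

Section ScaledLimit.
Variable R : realType.
Implicit Types (p : R).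

Lemma cvg_invr_pinfty : p^-1 @[p --> (+oo : set_system R)] --> (0 : R).
Proof.
apply/gtr0_cvgV0; last exact: cvg_id.
by apply: nbhs_pinfty_gt; exact: num_real.
Qed.

Lemma cvg_exprn (F : set_system R) (FF : Filter F) (f : R -> R) (a : R) n :
  f p @[p --> F] --> a -> f p ^+ n @[p --> F] --> a ^+ n.
Proof.
move=> fa; apply: (@cvg_comp _ _ _ f (fun y => y ^+ n) _ (nbhs a)) => //.
exact: exprn_continuous.
Qed.

(* A multiplicative form of Fekete's subadditivity lemma: the limit is the
   infimum of [b (p + c) / p ^+ d]. *)
Lemma scaled_limit (b : R -> R) (d : nat) (c : R) : 0 <= c ->
  (forall p, 0 <= b p) -> {homo b : x y / x <= y} ->
  (forall (m : nat) p, 0 < p -> b (m.+1%:R * p) <= m.+1%:R ^+ d * b (p + c)) ->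
  exists V : R, b p / p ^+ d @[p --> +oo] --> V.
Proof.
move=> c0 b0 bh bs.
pose E := [set b (p + c) / p ^+ d | p in [set p : R | 0 < p]].
have E0 : E !=set0 by exists (b (1 + c) / 1 ^+ d); exists 1 => //=; exact: ltr01.
have Elb : lbound E 0.
  by move=> _ [p /= p0 <-]; rewrite divr_ge0 // exprn_ge0 // ltW.
have hE : has_inf E by split=> //; exists 0.
exists (inf E).
(* Lower bound: the element of [E] at [P - c] gives [inf E * (P - c) ^+ d <= b P]. *)
have lower : inf E * (1 - c * P^-1) ^+ d @[P --> +oo] --> inf E.
  rewrite -[X in _ --> X]mulr1; apply: cvgM; first exact: cvg_cst.
  rewrite -[X in _ --> X](expr1n _ d); apply: cvg_exprn.
  rewrite -[X in _ --> X]subr0 -[X in _ --> _ - X](mulr0 c).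
  apply: cvgB; first exact: cvg_cst.
  by apply: cvgM; [exact: cvg_cst|exact: cvg_invr_pinfty].
apply/cvgrPdist_lt => e e0.
have [_ [p /= p0 <-] pe] := inf_adherent e0 hE.
(* Upper bound: for a nearly optimal [p], round [P] up to a multiple [m.+1 * p] with
   [m.+1 <= P / p + 1]. *)
have upper : (p^-1 + P^-1) ^+ d * b (p + c) @[P --> +oo] --> b (p + c) / p ^+ d.
  rewrite mulrC -exprVn; apply: cvgM; last exact: cvg_cst.
  apply: cvg_exprn; rewrite -[X in _ --> X]addr0.
  by apply: cvgD; [exact: cvg_cst|exact: cvg_invr_pinfty].
near=> P.
have P0 : 0 < P by near: P; apply: nbhs_pinfty_gt; exact: num_real.
have Pc : c < P by near: P; apply: nbhs_pinfty_gt; exact: num_real.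
have h1 : inf E * (1 - c * P^-1) ^+ d > inf E - e.
  near: P; apply: (cvgr_gt (inf E)) => //.
  by rewrite ltrBlDr ltrDl.
have h2 : (p^-1 + P^-1) ^+ d * b (p + c) < inf E + e.
  by near: P; apply: (cvgr_lt (b (p + c) / p ^+ d)).
have h3 : inf E * (1 - c * P^-1) ^+ d <= b P / P ^+ d.
  rewrite ler_pdivlMr ?exprn_gt0 // -mulrA -exprMn mulrBl mul1r divfK ?gt_eqF //.
  rewrite -ler_pdivlMr ?exprn_gt0 ?subr_gt0 //.
  apply: ge_inf; first by exists 0.
  by exists (P - c); rewrite /= ?subr_gt0 // subrK.
have h4 : b P / P ^+ d <= (p^-1 + P^-1) ^+ d * b (p + c).
  rewrite ler_pdivrMr ?exprn_gt0 // mulrAC -exprMn.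
  pose m := Num.trunc (P / p).
  have Pp0 : 0 <= P / p by rewrite divr_ge0 // ltW.
  have mP : P <= m.+1%:R * p by rewrite -ler_pdivrMr //; exact/ltW/truncnS_gt.
  apply: le_trans (bh _ _ mP) _; apply: le_trans (bs m p p0) _.
  rewrite ler_wpM2r // lerXn2r ?nnegrE //.
    by rewrite mulr_ge0 ?addr_ge0 ?invr_ge0 // ltW.
  rewrite mulrDl mulVf ?gt_eqF // -natr1 lerD2r mulrC.
  by rewrite /m truncn_le.
by rewrite ltr_distl; apply/andP; split; lra.
Unshelve. all: by end_near.
Qed.

End ScaledLimit.

(** * Rounding lattice points to a coarser scale *)

Section BallCountLimit.
Variables (R : realType) (q : R) (hq : 1 <= q) (d : nat).
Implicit Types (x y : 'rV[int]_d) (p : R).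

Let q0 : 0 < q. Proof. by rewrite (lt_le_trans ltr01). Qed.

Lemma powR_convex (t u v : R) : 0 <= t <= 1 -> 0 <= u -> 0 <= v ->
  (t * u + (1 - t) * v) `^ q <= t * u `^ q + (1 - t) * v `^ q.
Proof.
move=> /andP[t0 t1] u0 v0.
have := @convex_powR R q hq (Itv01 t0 t1) u v; rewrite !inE /= !in_itv /= !andbT.
by move=> /(_ u0 v0); rewrite !convRE.
Qed.

Definition floor_div (m : nat) x : 'rV[int]_d := \row_i (x 0%R i %/ m.+1%:Z)%Z.

Definition remainder (m : nat) x : {ffun 'I_d -> 'I_m.+1} :=
  [ffun i => inord (absz (x 0%R i %% m.+1%:Z)%Z)].

(** Hence the fibres of [floor_div m] have at most [m.+1 ^ d] points, the factor in
    [ball_count_scale]. *)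
Lemma floor_div_remainder_inj m x y :
  floor_div m x = floor_div m y -> remainder m x = remainder m y -> x = y.
Proof.
move=> /rowP fxy /ffunP rxy; apply/rowP => i.
have := fxy i; have := rxy i; rewrite !ffunE !mxE => /(congr1 val) /=.
have h z : (absz (z %% m.+1%:Z)%Z < m.+1)%N.
  have := modz_ge0 z (isT : m.+1%:Z != 0); have := ltz_pmod z (isT : 0 < m.+1%:Z).
  by lia.
rewrite !inordK // => r f.
rewrite (divz_eq (x 0 i) m.+1%:Z) (divz_eq (y 0 i) m.+1%:Z) f; congr (_ + _).
have := modz_ge0 (x 0 i) (isT : m.+1%:Z != 0).
have := modz_ge0 (y 0 i) (isT : m.+1%:Z != 0).
by move: r; lia.
Qed.

Lemma abs_floor_div m x i :
  `|(floor_div m x 0 i)%:~R| <= `|(x 0 i)%:~R| / m.+1%:R + 1 :> R.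
Proof.
rewrite mxE -[X in _ / X]/(m.+1%:Z%:~R) -!intr_norm.
rewrite -lerBlDr ler_pdivlMr ?ltr0z // mulrBl mul1r -intrM -intrB ler_int.
have := divz_eq (x 0 i) m.+1%:Z; have := modz_ge0 (x 0 i) (isT : m.+1%:Z != 0).
have := ltz_pmod (x 0 i) (isT : 0 < m.+1%:Z).
set u := divz _ _; set v := modz _ _; move: u v => u v; nia.
Qed.

(** A case of Minkowski's inequality: rounding adds at most 1 to each absolute value, and the
    all-ones vector has norm at most [d]. It is derived from convexity of the [q]-th power. *)
Lemma qnorm_floor_div m x p : (0 < d)%N -> 0 < p ->
  qnorm q (toR R x) <= m.+1%:R * p -> qnorm q (toR R (floor_div m x)) <= p + d%:R.
Proof.
move=> d0 p0; have dR : 0 < d%:R :> R by rewrite ltr0n.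
have pd : 0 < p + d%:R by rewrite addr_gt0.
have mp0 : 0 < m.+1%:R * p by rewrite mulr_gt0.
move=> xp'; have xp : qsum q x <= (m.+1%:R * p) `^ q.
  by rewrite -(qnorm_le hq x (ltW mp0)).
suff : qsum q (floor_div m x) <= (p + d%:R) `^ q.
  by rewrite -(qnorm_le hq (floor_div m x) (ltW pd)).
(* With this weight, [a i + 1] is [p + d] times the convex combination of [a i / p] and [1 / d]. *)
pose t := p / (p + d%:R).
have t01 : 0 <= t <= 1.
  by rewrite /t divr_ge0 ?(ltW p0) ?(ltW pd) //= ler_pdivrMr // mul1r lerDl ltW.
have tE : 1 - t = d%:R / (p + d%:R).
  by rewrite /t; field; rewrite gt_eqF.
pose a i : R := `|(x 0 i)%:~R| / m.+1%:R.
have a0 i : 0 <= a i by rewrite divr_ge0.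
have step i : `|(floor_div m x 0 i)%:~R| `^ q <=
    (p + d%:R) `^ q * (t * (a i / p) `^ q + (1 - t) * (d%:R^-1) `^ q).
  apply: (@le_trans _ _ ((a i + 1) `^ q)).
    apply: ge0_ler_powR; rewrite ?nnegrE ?addr_ge0 ?(ltW q0) //.
    exact: abs_floor_div.
  have -> : a i + 1 = (p + d%:R) * (t * (a i / p) + (1 - t) * d%:R^-1).
    rewrite tE /t; field; rewrite ?gt_eqF //.
  rewrite powRM ?(ltW pd) //; last first.
    case/andP: t01 => t0 t1.
    by rewrite addr_ge0 // mulr_ge0 ?subr_ge0 ?invr_ge0 ?(ltW dR) // divr_ge0 // ltW.
  rewrite ler_wpM2l ?powR_ge0 //; apply: powR_convex => //.
  by rewrite divr_ge0 // ltW.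
apply: (le_trans (ler_sum _ (fun i _ => step i))).
rewrite -mulr_sumr -[leRHS]mulr1 ler_wpM2l ?powR_ge0 // big_split /= -!mulr_sumr.
rewrite sumr_const card_ord -[leRHS](subrKC t).
apply: lerD.
  rewrite -[leRHS]mulr1 ler_wpM2l; [by []|by case/andP: t01|].
  have -> : \sum_(i < d) (a i / p) `^ q = qsum q x / (m.+1%:R * p) `^ q.
    rewrite mulr_suml; apply: eq_bigr => i _.
    rewrite /a -mulrA -invfM powRM ?invr_ge0 ?(ltW mp0) //; congr (_ * _).
    have pq0 : (m.+1%:R * p) `^ q != 0 by rewrite gt_eqF // powR_gt0.
    apply: (mulIf pq0); rewrite mulVf // -powRM ?invr_ge0 ?(ltW mp0) //.
    by rewrite mulVf ?gt_eqF // powR1.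
  by rewrite ler_pdivrMr ?powR_gt0 // mul1r.
rewrite -[leRHS]mulr1 ler_wpM2l ?subr_ge0; [by []|by case/andP: t01|].
(* The [d] terms, each the [q]-th power of [1 / d], add up to at most 1 because [1 <= q]. *)
rewrite -[leLHS]mulr_natr -ler_pdivlMr // mul1r.
rewrite -[leRHS]powRr1 ?invr_ge0 // ger_powR // invr_gt0 dR invf_le1 //.
by rewrite ler1n.
Qed.

Lemma ball_count_mono : {homo (fun p => (ball_count q d p)%:R : R) : x y / x <= y}.
Proof.
move=> p p' pp'; rewrite ler_nat; apply: fsubset_leq_card.
rewrite -fset_set_sub; [|exact: finite_lattice_ball..].
by move=> x /le_trans; apply.
Qed.

Lemma ball_count_scale (m : nat) p : (0 < d)%N -> 0 < p ->
  (ball_count q d (m.+1%:R * p))%:R <= m.+1%:R ^+ d * (ball_count q d (p + d%:R))%:R :> R.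
Proof.
move=> d0 p0; rewrite -natrX -natrM ler_nat.
pose U := fset_set (lattice_ball q (d := d) (m.+1%:R * p)).
pose V := fset_set (lattice_ball q (d := d) (p + d%:R)).
have UV (x : U) : floor_div m (val x) \in V.
  have := valP x; rewrite !in_fset_set; [|exact: finite_lattice_ball..].
  by rewrite !inE; exact: qnorm_floor_div.
pose h (x : U) : V * {ffun 'I_d -> 'I_m.+1} := ([` UV x]%fset, remainder m (val x)).
have hi : injective h.
  by move=> x y [/= f r]; apply: val_inj; exact: floor_div_remainder_inj f r.
have := leq_card h hi; rewrite card_prod card_ffun !card_ord mulnC.
by rewrite /ball_count !cardfE.
Qed.

Lemma ball_count_cvg : (0 < d)%N -> exists V : R,
  (ball_count q d p)%:R / p ^+ d @[p --> +oo] --> V.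
Proof.
move=> d0; apply: (@scaled_limit R (fun p => (ball_count q d p)%:R) d d%:R) => //.
  exact: ball_count_mono.
by move=> m p p0; exact: ball_count_scale.
Qed.

End BallCountLimit.


(** * Laplace sums and the volume constant *)

Section ExponentialIntegral.
Variable R : realType.
Notation mu := (@lebesgue_measure R).

Lemma integral_expRN (r a : R) : 0 < r ->
  (\int[mu]_(t in `[a, +oo[) (expR (- (r * t)))%:E = (expR (- (r * a)) / r)%:E)%E.
Proof.
move=> r0.
pose F (t : R) := - r^-1 * expR (- (r * t)).
have dF x : is_derive x (1 : R) F (expR (- (r * x))).
  rewrite /F; apply: is_derive_eq.
  by rewrite !scaler1 /GRing.scale /=; field; rewrite gt_eqF.
have cf : continuous (fun t : R => expR (- (r * t))).
  move=> x; apply: continuous_comp; last exact: continuous_expR.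
  by apply: continuousN; apply: continuousM => //; exact: cst_continuous.
rewrite (@ge0_continuous_FTC2y _ _ F a 0).
- by rewrite sub0e -EFinN /F; congr EFin; rewrite mulNr opprK mulrC.
- by move=> x _; exact: expR_ge0.
- exact: continuous_subspaceT.
- rewrite /F -[X in _ --> X](mulr0 (- r^-1)); apply: cvgM; first exact: cvg_cst.
  apply: (@cvg_comp _ _ _ (fun t => r * t) (fun z => expR (- z)) _ (pinfty_nbhs R)); last exact: cvgr_expR.
  exact: gt0_cvgMry.
- by move=> x _; exact: ex_derive.
- apply/cvg_at_right_filter; apply: cvgM; first exact: cvg_cst.
  exact: cf.
- by move=> x _; rewrite derive1E derive_val.
Qed.

Lemma measurable_expRN (r : R) (D : set R) :
  measurable_fun D (EFin \o (fun t : R => expR (- (r * t)))).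
Proof.
apply: measurable_funTS; apply/measurable_EFinP; apply: continuous_measurable_fun => x.
apply: continuous_comp; last exact: continuous_expR.
by apply: continuousN; apply: continuousM => //; exact: cst_continuous.
Qed.

Lemma integrable_expRN (r : R) : 0 < r ->
  mu.-integrable `]0, +oo[ (EFin \o (fun t : R => expR (- (r * t)))).
Proof.
move=> r0; apply: (@integrableS _ _ _ mu `[0, +oo[) => //.
  by apply: subset_itvr; rewrite bnd_simp.
apply/integrableP; split; first exact: measurable_expRN.
under eq_integral do rewrite /= ger0_norm ?expR_ge0 //.
by rewrite integral_expRN // ltry.
Qed.

(** The layer cake formula for one point: with [a] equal to [qsum q x / m], summing over [x] turns a
    Laplace sum into an integral of point counts. *)
Lemma integral_expRN_ge (a : R) : 0 <= a ->
  (\int[mu]_(t in `]0%R, +oo[) (expR (- t) * (a <= t)%R%:R)%:E = (expR (- a))%:E)%E.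
Proof.
move=> a0.
have mI : measurable_fun setT (fun t : R => (a <= t)%R%:R : R).
  rewrite (_ : (fun t => _) = \1_(`[a, +oo[ : set R)).
    exact: measurable_indic.
  apply/funext => t; rewrite indicE; congr (nat_of_bool _)%:R.
  by apply/idP/idP; rewrite ?inE /= in_itv /= andbT.
have mE : measurable_fun setT (fun t : R => expR (- t)).
  by apply: measurableT_comp => //; exact: measurable_funN.
rewrite integral_itv_obnd_cbnd; last first.
  apply: measurable_funTS; apply/measurable_EFinP; exact: measurable_funM.
rewrite -[RHS](_ : (expR (- (1 * a)) / 1)%:E = _); last by rewrite mul1r divr1.
rewrite -integral_expRN // [LHS]integral_mkcond [RHS]integral_mkcond.
apply: eq_integral => t _; rewrite !patchE mul1r.
have [at_|at_] := leP a t.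
  rewrite mulr1 !ifT // inE /= in_itv /= andbT //.
  exact: le_trans a0 at_.
rewrite mulr0 [in RHS]ifF; last by apply/negP; rewrite inE /= in_itv /= andbT leNgt at_.
by case: ifP.
Qed.

End ExponentialIntegral.


(** * Truncated Laplace sums and the integrable majorant *)

Section Laplace.
Variables (R : realType) (q : R) (hq : 1 <= q) (d : nat).
Notation mu := (@lebesgue_measure R).
Implicit Types (p t T : R).

Let q0 : 0 < q. Proof. by rewrite (lt_le_trans ltr01). Qed.

Local Notation box n := {ffun 'I_d -> 'I_(n.*2.+1)}.

Definition box_count n T : R := \sum_(f : box n) (qsum q (box_point f) <= T)%R%:R.

(** The Laplace sum is cut off to a cube rather than a ball: it is then finite and still factors
    over the coordinates. *)
Definition box_sum n (m : R) : R := \sum_(f : box n) expR (- (qsum q (box_point f) / m)).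

Lemma box_sum_integral n (m c : R) : 0 < m -> 0 <= c ->
  (\int[mu]_(t in `]0%R, +oo[) (c * (expR (- t) * box_count n (m * t)))%:E =
  (c * box_sum n m)%:E)%E.
Proof.
move=> m0 c0.
have mI (f : box n) : measurable_fun setT
    (fun t : R => expR (- t) * (qsum q (box_point f) <= m * t)%R%:R : R).
  apply: measurable_funM.
    by apply: measurableT_comp => //; exact: measurable_funN.
  rewrite (_ : (fun t => _) = \1_(`[qsum q (box_point f) / m, +oo[ : set R)).
    exact: measurable_indic.
  apply/funext => t; rewrite indicE; congr (nat_of_bool _)%:R.
  by rewrite -ler_pdivrMl // mulrC; apply/idP/idP; rewrite ?inE /= in_itv /= andbT.
have E (t : R) : (c * (expR (- t) * box_count n (m * t)))%:E =
    (c%:E * \sum_(f : box n) (expR (- t) * (qsum q (box_point f) <= m * t)%R%:R)%:E)%E.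
  by rewrite sumEFin -mulr_sumr EFinM.
under eq_integral do rewrite E.
rewrite ge0_integralZl //; last first.
- by move=> t _; apply: sume_ge0 => f _; rewrite lee_fin mulr_ge0 ?expR_ge0.
- apply: emeasurable_sum => f; apply: measurable_funTS; apply/measurable_EFinP; exact: mI.
rewrite ge0_integral_sum //; last first.
- by move=> f; apply: measurable_funTS; apply/measurable_EFinP; exact: mI.
rewrite EFinM; congr (_ * _)%E; rewrite -sumEFin; apply: eq_bigr => f _.
rewrite -integral_expRN_ge; last by rewrite divr_ge0 ?qsum_ge0 // ltW.
by apply: eq_integral => t _; rewrite ler_pdivrMr // [m * t]mulrC.
Qed.

Lemma box_sumE n (m : R) : box_sum n m =
  (\sum_(j < n.*2.+1) expR (- (`|(j%:Z - n%:Z)%:~R| `^ q / m))) ^+ d.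
Proof.
rewrite -[X in _ ^+ X]card_ord -prodr_const bigA_distr_bigA.
apply: eq_bigr => f _; rewrite /qsum mulr_suml -sumrN expR_sum.
by apply: eq_bigr => i _; rewrite mxE.
Qed.

Lemma box_count_card n T :
  box_count n T = #|[pred f : box n | (qsum q (box_point f) <= T)%R]|%:R.
Proof. by rewrite /box_count -sum1_card natr_sum [RHS]big_mkcond; apply: eq_bigr => f _; rewrite inE; case: ifP. Qed.

Lemma mem_lattice_ball T (x : 'rV[int]_d) : 0 <= T ->
  (x \in fset_set (lattice_ball q (T `^ q^-1))) = (qsum q x <= T).
Proof.
move=> T0; rewrite in_fset_set; last exact: finite_lattice_ball.
have h := qnorm_le hq x (powR_ge0 T q^-1); rewrite powRVK // in h.
by rewrite -h; apply/idP/idP; rewrite inE.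
Qed.

Lemma box_count_le n T : 0 <= T ->
  box_count n T <= (ball_count q d (T `^ q^-1))%:R.
Proof.
move=> T0; rewrite box_count_card ler_nat cardE -(size_map (@box_point d n)).
apply: uniq_leq_size; first by rewrite map_inj_uniq ?enum_uniq //; exact: box_point_inj.
by move=> _ /mapP [f + ->]; rewrite mem_enum inE mem_lattice_ball.
Qed.

Lemma box_count_eq n T : 0 <= T -> T `^ q^-1 <= n%:R ->
  box_count n T = (ball_count q d (T `^ q^-1))%:R.
Proof.
move=> T0 Tn; apply/eqP; rewrite eq_le box_count_le //=.
rewrite box_count_card ler_nat cardE -(size_map (@box_point d n)).
apply: uniq_leq_size; first exact: fset_uniq.
move=> x; rewrite mem_lattice_ball // => xT.
have [|f fE] := @box_point_surj d n x.
  apply: (lattice_ball_bound hq Tn); rewrite /lattice_ball /=.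
  by rewrite (qnorm_le hq) ?powR_ge0 // powRVK.
by apply/mapP; exists f => //; rewrite mem_enum inE -fE.
Qed.

Lemma ball_count_le p : 0 <= p -> (ball_count q d p)%:R <= (2 * p + 1) ^+ d :> R.
Proof.
move=> p0; pose n := Num.trunc p.
apply: (@le_trans _ _ ((n.*2.+1 ^ d)%:R)).
  rewrite ler_nat -[X in (_ <= X ^ _)%N]card_ord -[X in (_ <= _ ^ X)%N]card_ord -card_ffun.
  rewrite cardE -(size_map (@box_point d n)); apply: uniq_leq_size; first exact: fset_uniq.
  move=> x; rewrite in_fset_set; last exact: finite_lattice_ball.
  rewrite inE => xp; have [|f ->] := @box_point_surj d n x.
    move=> i; rewrite /n truncn_ge_nat //.
    exact: le_trans (abs_le_qnorm hq x i) xp.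
  by apply: map_f; rewrite mem_enum.
rewrite natrX lerXn2r ?nnegrE ?addr_ge0 ?mulr_ge0 //.
by rewrite -natr1 -muln2 natrM mulrC lerD2r ler_pM2l // truncn_le.
Qed.

Lemma powR_le1D t : 0 <= t -> t `^ q^-1 <= 1 + t.
Proof.
move=> t0; have [t1|t1] := leP t 1.
  apply: (@le_trans _ _ (1 `^ q^-1)); last by rewrite powR1 lerDl.
  by apply: ge0_ler_powR; rewrite ?nnegrE ?invr_ge0 ?(ltW q0).
apply: (@le_trans _ _ (t `^ 1)); last by rewrite powRr1 // lerDr.
by apply: ler_powR; rewrite ?(ltW t1) // invf_le1.
Qed.

Lemma powR_div t : 0 <= t -> t `^ (d%:R / q) = (t `^ q^-1) ^+ d.
Proof. by move=> t0; rewrite mulrC powRrM powR_mulrn ?powR_ge0. Qed.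

Definition tail_const : R := (3 + 4 * d%:R) ^+ d.

(** Take [d]-th powers in [3 + 2 * t <= (3 + 4 * d) * (1 + t / (2 * d))], whose last factor is at
    most [expR (t / (2 * d))]. *)
Lemma tail_bound t : (0 < d)%N -> 0 <= t ->
  expR (- t) * (3 + 2 * t) ^+ d <= tail_const * expR (- (2^-1 * t)).
Proof.
move=> d0 t0; have dR : 0 < d%:R :> R by rewrite ltr0n.
have -> : - (2^-1 * t) = - t + (t / (2 * d%:R)) * d%:R by field; rewrite gt_eqF.
rewrite expRD mulrCA ler_wpM2l ?expR_ge0 // expRM_natr /tail_const -exprMn.
rewrite lerXn2r ?nnegrE ?mulr_ge0 ?addr_ge0 ?expR_ge0 ?mulr_ge0 //.
apply: (@le_trans _ _ ((3 + 4 * d%:R) * (1 + t / (2 * d%:R)))); last first.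
  by rewrite ler_wpM2l ?addr_ge0 ?mulr_ge0 // expR_ge1Dx.
have -> : (3 + 4 * d%:R) * (1 + t / (2 * d%:R)) =
    3 + 2 * t + (4 * d%:R + 3 * t / (2 * d%:R)) by field; rewrite gt_eqF.
by rewrite lerDl addr_ge0 ?mulr_ge0 ?invr_ge0 ?mulr_ge0.
Qed.

Lemma integrable_tail : mu.-integrable `]0, +oo[
  (EFin \o (fun t : R => tail_const * expR (- (2^-1 * t)))).
Proof.
have := @integrableZl _ _ _ mu `]0, +oo[ (measurable_itv _) tail_const _
  (@integrable_expRN R 2^-1 _).
by apply; rewrite invr_gt0.
Qed.

Lemma measurable_gamma_integrand (D : set R) (a : R) :
  measurable_fun D (EFin \o (fun t : R => t `^ a * expR (- t))).
Proof.
apply: measurable_funTS; apply/measurable_EFinP; apply: measurable_funM.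
  exact: measurable_powR.
by apply: measurableT_comp => //; exact: measurable_funN.
Qed.

(** The same majorant applies, as the power of [t] is at most [(1 + t) ^+ d]. [Gamma] is the finite
    part of an integral, so integrability ensures that it is the actual value. *)
Lemma integrable_gamma : (0 < d)%N -> mu.-integrable `]0, +oo[
  (EFin \o (fun t : R => t `^ (d%:R / q + 1 - 1) * expR (- t))).
Proof.
move=> d0; apply: le_integrable integrable_tail => //.
  exact: measurable_gamma_integrand.
move=> t; rewrite /= in_itv /= andbT => t0; rewrite lee_fin.
rewrite ger0_norm ?mulr_ge0 ?powR_ge0 ?expR_ge0 //.
rewrite ger0_norm ?mulr_ge0 ?exprn_ge0 ?addr_ge0 ?expR_ge0 ?mulr_ge0 //.
apply: le_trans (tail_bound d0 (ltW t0)).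
rewrite mulrC ler_wpM2l ?expR_ge0 // addrK powR_div ?(ltW t0) //.
rewrite lerXn2r ?nnegrE ?powR_ge0 ?addr_ge0 ?mulr_ge0 ?(ltW t0) //.
by apply: le_trans (powR_le1D (ltW t0)) _; lra.
Qed.

(** From 1 on the integrand is at least [expR (- t)], whose integral there is [expR (- 1)]. *)
Lemma Gamma_gt0 : (0 < d)%N -> 0 < Gamma (d%:R / q + 1).
Proof.
move=> d0; apply: (@lt_le_trans _ _ (expR (- 1 : R))); first exact: expR_gt0.
have ig := integrable_gamma d0.
rewrite /Gamma /Rintegral -[leLHS]/(fine (expR (- 1))%:E) -integral_expRN_ge //.
rewrite fine_le //; last 2 first.
- exact: integrable_fin_num ig.
- apply: ge0_le_integral => //.
  + apply: measurable_funTS; apply/measurable_EFinP; apply: measurable_funM.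
      by apply: measurableT_comp => //; exact: measurable_funN.
    rewrite (_ : (fun t => _) = \1_(`[1, +oo[ : set R)).
      exact: measurable_indic.
    apply/funext => t; rewrite indicE; congr (nat_of_bool _)%:R.
    by apply/idP/idP; rewrite ?inE /= in_itv /= andbT.
  + exact: measurable_gamma_integrand.
  + move=> t _; rewrite lee_fin mulrC ler_wpM2r ?expR_ge0 // addrK.
    have [t1|t1] := leP 1 t; last by rewrite powR_ge0.
    rewrite -[leLHS](powRr0 t); apply: ler_powR => //.
    by rewrite divr_ge0 // ltW.
- by rewrite integral_expRN_ge.
Qed.

End Laplace.


(** * Asymptotics of Laplace sums by dominated convergence *)

Section LaplaceLimit.
Variables (R : realType) (q : R) (hq : 1 <= q) (d : nat).
Notation mu := (@lebesgue_measure R).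
Implicit Types (p t T : R).

Let q0 : 0 < q. Proof. by rewrite (lt_le_trans ltr01). Qed.

(** For each fixed [t], quadratic growth makes the cube eventually contain the ball of radius
    [(k.+1 * t) ^ (1 / q)], which is at most [1 + k.+1 * t]. *)
Definition box_radius (k : nat) : nat := (k.+1 ^ 2)%N.

(** The domination: at most [(2 * r + 1) ^+ d] points lie in the ball of radius
    [r = (m * t) ^ (1 / q)], and [2 * r + 1] is at most [m ^ (1 / q) * (3 + 2 * t)]. *)
Lemma scaled_box_count_bound k t : (0 < d)%N -> 0 <= t ->
  (k.+1%:R `^ (d%:R / q))^-1 * (expR (- t) * box_count q d (box_radius k) (k.+1%:R * t))
    <= tail_const R d * expR (- (2^-1 * t)).
Proof.
move=> d0 t0; set m : R := k.+1%:R; have m0 : 0 < m by rewrite ltr0n.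
have m1 : 1 <= m by rewrite ler1n.
have mt0 : 0 <= m * t by rewrite mulr_ge0 // ltW.
have mq1 : 1 <= m `^ q^-1.
  by rewrite -(powRr0 m) ler_powR // invr_ge0 ltW.
have mq0 : 0 < m `^ q^-1 by rewrite (lt_le_trans ltr01).
apply: le_trans (tail_bound d0 t0).
rewrite mulrCA ler_wpM2l ?expR_ge0 // powR_div ?(ltW m0) // mulrC ler_pdivrMr ?exprn_gt0 //.
apply: le_trans (box_count_le hq d _ mt0) _.
apply: le_trans (ball_count_le hq _ (powR_ge0 _ _)) _.
rewrite -exprMn lerXn2r ?nnegrE ?addr_ge0 ?mulr_ge0 ?powR_ge0 ?(ltW mq0) //.
  by rewrite addr_ge0 // mulr_ge0.
rewrite powRM ?(ltW m0) //.
have := powR_le1D hq t0; have := powR_ge0 t q^-1.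
move: (t `^ q^-1) (m `^ q^-1) mq1 => a b *; nra.
Qed.

Lemma cvg_scaled_root t : 0 < t -> (k.+1%:R * t) `^ q^-1 @[k --> \oo] --> (+oo : set_system R).
Proof.
move=> t0; apply/cvgryPge => A; near=> k.
apply: (@le_trans _ _ `|A|); first exact: ler_norm.
rewrite -[leLHS](powRKV hq (normr_ge0 A)).
apply: ge0_ler_powR; rewrite ?nnegrE ?powR_ge0 ?invr_ge0 ?(ltW q0) ?mulr_ge0 ?(ltW t0) //.
rewrite -ler_pdivrMr //; apply: (@le_trans _ _ k%:R); last by rewrite ler_nat.
by near: k; exact: nbhs_infty_ger.
Unshelve. all: by end_near.
Qed.

Lemma scaled_box_count_cvg (V t : R) : (0 < d)%N -> 0 < t ->
  (ball_count q d p)%:R / p ^+ d @[p --> +oo] --> V ->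
  (k.+1%:R `^ (d%:R / q))^-1 * (expR (- t) * box_count q d (box_radius k) (k.+1%:R * t))
    @[k --> \oo] --> V * (t `^ (d%:R / q + 1 - 1) * expR (- t)).
Proof.
move=> d0 t0 HV.
have HV' := @cvg_comp _ _ _ _ _ _ _ _ (cvg_scaled_root t0) HV.
have : ((t `^ (d%:R / q) * expR (- t)) *
    ((fun p => (ball_count q d p)%:R / p ^+ d) \o (fun k : nat => (k.+1%:R * t) `^ q^-1)) k)
    @[k --> \oo] --> (t `^ (d%:R / q) * expR (- t)) * V.
  by apply: cvgM => //; exact: cvg_cst.
rewrite addrK [X in _ -> _ --> X]mulrC; apply: cvg_trans.
apply: near_eq_cvg; near=> k => /=.
set m : R := k.+1%:R; have m0 : 0 < m by rewrite ltr0n.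
have mt0 : 0 <= m * t by rewrite mulr_ge0 // ltW.
rewrite (box_count_eq hq d mt0); last first.
  (* Once [t <= k], that is [t <= m - 1], one has [1 + m * t <= m ^ 2], so the cube truncates
     nothing. *)
  apply: le_trans (powR_le1D hq mt0) _.
  have tk : t <= k%:R by near: k; exact: nbhs_infty_ger.
  have m1 : 1 <= m by rewrite ler1n.
  have mE : m = k%:R + 1 by rewrite /m -natr1.
  rewrite /box_radius natrX -/m expr2; nra.
have e : (m * t) `^ (d%:R / q) = m `^ (d%:R / q) * t `^ (d%:R / q).
  by rewrite powRM // ltW.
rewrite -(powR_div q d mt0) e.
have a0 : m `^ (d%:R / q) != 0 by rewrite gt_eqF // powR_gt0.
have b0 : t `^ (d%:R / q) != 0 by rewrite gt_eqF // powR_gt0.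
by field; rewrite a0 b0.
Unshelve. all: by end_near.
Qed.

Lemma measurable_box_count (D : set R) n (c m : R) : 0 < m ->
  measurable_fun D (EFin \o (fun t : R => c * (expR (- t) * box_count q d n (m * t)))).
Proof.
move=> m0; apply: measurable_funTS; apply/measurable_EFinP.
apply: measurable_funM => //; apply: measurable_funM.
  by apply: measurableT_comp => //; exact: measurable_funN.
apply: measurable_sum => f.
rewrite (_ : (fun t => _) = \1_(`[qsum q (box_point f) / m, +oo[ : set R)).
  exact: measurable_indic.
apply/funext => t; rewrite indicE; congr (nat_of_bool _)%:R.
by rewrite -ler_pdivrMl // mulrC; apply/idP/idP; rewrite ?inE /= in_itv /= andbT.
Qed.

Lemma box_sum_cvg (V : R) : (0 < d)%N ->
  (ball_count q d p)%:R / p ^+ d @[p --> +oo] --> V ->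
  (k.+1%:R `^ (d%:R / q))^-1 * box_sum q d (box_radius k) k.+1%:R @[k --> \oo]
    --> V * Gamma (d%:R / q + 1).
Proof.
move=> d0 HV.
pose f_ (k : nat) (t : R) : \bar R := ((k.+1%:R `^ (d%:R / q))^-1 *
  (expR (- t) * box_count q d (box_radius k) (k.+1%:R * t)))%:E.
pose f (t : R) : \bar R := (V * (t `^ (d%:R / q + 1 - 1) * expR (- t)))%:E.
have ig := integrable_gamma hq d0.
have mI : measurable (`]0, +oo[%classic : set R) by [].
have [] := @dominated_convergence _ _ R mu `]0, +oo[%classic mI f_ f
  (EFin \o (fun t : R => tail_const R d * expR (- (2^-1 * t)))).
- by move=> k; exact: measurable_box_count.
- have /integrableP[] := @integrableZl _ _ _ mu _ mI V _ ig.
  by move=> + _; congr measurable_fun.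
- apply: aeW => t; rewrite /= in_itv /= andbT => t0.
  apply: cvg_EFin; first by apply: nearW.
  exact: scaled_box_count_cvg.
- exact: integrable_tail.
- apply: aeW => t k; rewrite /= in_itv /= andbT => t0.
  rewrite lee_fin ger0_norm; first by apply: scaled_box_count_bound => //; exact: ltW.
  rewrite mulr_ge0 ?invr_ge0 ?powR_ge0 // mulr_ge0 ?expR_ge0 //.
  by apply: sumr_ge0.
move=> _ _.
have -> : (\int[mu]_(x in `]0%R, +oo[) f x)%E = (V * Gamma (d%:R / q + 1))%:E.
  rewrite /f; under eq_integral do rewrite EFinM.
  rewrite integralZl // EFinM /Gamma /Rintegral fineK //.
  exact: integrable_fin_num ig.
move=> /fine_cvg; apply: cvg_trans; apply: near_eq_cvg; near=> k => /=.
by rewrite /f_ box_sum_integral // invr_ge0 powR_ge0.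
Unshelve. all: by end_near.
Qed.

End LaplaceLimit.

(** * The value of the limit constant *)

Section BallVolume.
Variables (R : realType) (q : R) (hq : 1 <= q).
Implicit Type p : R.

Lemma ball_count1 p : 0 <= p -> 2 * p - 1 <= (ball_count q 1 p)%:R.
Proof.
move=> p0; pose n := Num.trunc p.
apply: (@le_trans _ _ (n.*2.+1%:R)).
  have : p < n.+1%:R by exact: truncnS_gt.
  by rewrite -!natr1 -muln2 natrM; lra.
rewrite ler_nat -[X in (X <= _)%N]expn1 -[X in (X ^ _ <= _)%N]card_ord -[X in (_ ^ X <= _)%N](card_ord 1) -card_ffun.
rewrite cardE -(size_map (@box_point 1 n)); apply: uniq_leq_size.
  by rewrite map_inj_uniq ?enum_uniq //; exact: box_point_inj.
move=> _ /mapP [f _ ->]; rewrite in_fset_set; last exact: finite_lattice_ball.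
rewrite inE /lattice_ball /= qnormE /qsum big_ord1 (powRKV hq) // -natr_abszR.
apply: (@le_trans _ _ n%:R); last by rewrite truncn_le.
by rewrite ler_nat box_point_bound.
Qed.

Lemma ball_count1_cvg : (ball_count q 1 p)%:R / p ^+ 1 @[p --> +oo] --> (2 : R).
Proof.
have lim s : 2 + s * p^-1 @[p --> (+oo : set_system R)] --> (2 : R).
  rewrite -[X in _ --> X]addr0 -[X in _ --> _ + X](mulr0 s); apply: cvgD.
    exact: cvg_cst.
  by apply: cvgM; [exact: cvg_cst|exact: cvg_invr_pinfty].
apply: (squeeze_cvgr _ (lim (-1)) (lim 1)).
near=> p.
have p0 : 0 < p by near: p; apply: nbhs_pinfty_gt; exact: num_real.
have e1 : (2 + -1 * p^-1) * p = 2 * p - 1 by field; rewrite gt_eqF.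
have e2 : (2 + 1 * p^-1) * p = 2 * p + 1 by field; rewrite gt_eqF.
rewrite expr1 ler_pdivlMr // ler_pdivrMr // e1 e2 ball_count1 ?(ltW p0) //=.
by rewrite -[leRHS]expr1 ball_count_le ?(ltW p0).
Unshelve. all: by end_near.
Qed.

Lemma ball_count_limit d : (0 < d)%N ->
  (ball_count q d p)%:R / p ^+ d @[p --> +oo] -->
    (2 * Gamma (1 / q + 1)) ^+ d / Gamma (d%:R / q + 1).
Proof.
move=> d0; have [V HV] := ball_count_cvg hq d0.
suff <- : V = (2 * Gamma (1 / q + 1)) ^+ d / Gamma (d%:R / q + 1) by [].
apply: (canRL (mulfK (lt0r_neq0 (Gamma_gt0 hq d0)))).
have H1 := box_sum_cvg hq (isT : (0 < 1)%N) ball_count1_cvg.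
have Hd := box_sum_cvg hq d0 HV.
have := @cvg_comp _ _ _ _ (fun y : R => y ^+ d) _ _ _ H1 (@exprn_continuous R d _).
move=> Hd'; apply: (cvg_unique _ Hd) => //.
apply: cvg_trans Hd'; apply: near_eq_cvg; near=> k => /=.
(* Both dimensions use the same radius and scale, so the [d]-dimensional sum is exactly the [d]-th
   power of the one-dimensional one. *)
rewrite !box_sumE expr1 exprMn exprVn; congr (_^-1 * _).
by rewrite (powR_div q d) // mul1r.
Unshelve. all: by end_near.
Qed.

End BallVolume.


(** * From lattice points to primitive points *)

Section ZetaSums.
Variables (R : realType) (d : nat).
Hypothesis hd : (2 <= d)%N.

Definition zeta_term (k : nat) : R := (k.+1%:R ^+ d)^-1.

Definition zeta_partial (n : nat) : R := \sum_(0 <= k < n) zeta_term k.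

Lemma zeta_term_ge0 k : 0 <= zeta_term k.
Proof. by rewrite invr_ge0 exprn_ge0. Qed.

Lemma zeta_term_le k : zeta_term k <= (k.+1%:R ^+ 2)^-1.
Proof. by rewrite lef_pV2 ?posrE ?exprn_gt0 // ler_weXn2l // ler1n. Qed.

Lemma zeta_partial_mono : {homo zeta_partial : n m / (n <= m)%N >-> n <= m}.
Proof.
move=> n m nm; rewrite /zeta_partial [leRHS](@big_cat_nat _ _ _ n) //= lerDl.
by apply: sumr_ge0 => k _; exact: zeta_term_ge0.
Qed.

Lemma zeta_partial1 : zeta_partial 1 = 1.
Proof. by rewrite /zeta_partial big_nat1 /zeta_term expr1n invr1. Qed.

(** Compare with squares and telescope from the third term on. The first two terms give at most
    [5 / 4], which is [7 / 4 - 1 / 2]. *)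
Lemma zeta_partial_le n : zeta_partial n <= 7 / 4.
Proof.
suff H m : zeta_partial m.+2 <= 7 / 4 - m.+2%:R^-1.
  have n2 : (n <= n.+2)%N by rewrite -addn2 leq_addr.
  apply: le_trans (zeta_partial_mono n2) _; apply: le_trans (H n) _.
  by rewrite gerBl.
elim: m => [|m IH].
  rewrite /zeta_partial big_nat_recr //= -/(zeta_partial 1) zeta_partial1.
  have := zeta_term_le 1; lra.
rewrite /zeta_partial big_nat_recr //= -/(zeta_partial m.+2).
have h := zeta_term_le m.+2.
have : (m.+3%:R ^+ 2)^-1 <= m.+2%:R^-1 - m.+3%:R^-1 :> R.
  have -> : m.+2%:R^-1 - m.+3%:R^-1 = (m.+2%:R * m.+3%:R)^-1 :> R.
    rewrite -[m.+3%:R]natr1; have : 0 < m.+2%:R :> R by rewrite ltr0n.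
    by move: (m.+2%:R : R) => x x0; field; rewrite !gt_eqF ?addr_gt0.
  by rewrite lef_pV2 ?posrE ?mulr_gt0 ?exprn_gt0 // expr2 ler_pM2r // ler_nat.
by move=> /(le_trans h) /(lerD IH); rewrite addrA subrK.
Qed.

Lemma zeta_partial_cvg : zeta_partial @ \oo --> zeta (d%:R : R).
Proof.
have -> : zeta (d%:R : R) = limn zeta_partial.
  rewrite /zeta; congr (limn _); apply/funext => n; rewrite /series /=.
  by apply: eq_bigr => k _; rewrite powR_mulrn.
apply: nondecreasing_is_cvgn; first exact: zeta_partial_mono.
by exists (7 / 4) => _ [n _ <-]; exact: zeta_partial_le.
Qed.

Lemma zeta_partial_le_zeta n : zeta_partial n <= zeta (d%:R : R).
Proof.
rewrite -(cvg_lim _ zeta_partial_cvg) //.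
apply: nondecreasing_cvgn_le; first exact: zeta_partial_mono.
exact: cvgP zeta_partial_cvg.
Qed.

Lemma zeta_ge1 : 1 <= zeta (d%:R : R).
Proof. by rewrite -[leLHS]zeta_partial1; exact: zeta_partial_le_zeta. Qed.

Lemma zeta_tail (e : R) : 0 < e -> exists2 K, (0 < K)%N &
  forall M, (K <= M)%N -> zeta (d%:R : R) - zeta_partial M <= e.
Proof.
move=> e0; have /cvgrPdist_lt/(_ e e0) [K _ HK] := zeta_partial_cvg.
exists K.+1 => // M KM; apply: le_trans (ler_norm _) (ltW _).
exact/HK/(leq_trans _ KM).
Qed.

End ZetaSums.

(** * Inverting the summation over multiples, without Möbius coefficients *)

Section Inversion.
Variables (R : realType) (d : nat) (b N : R -> R) (V C : R).
Hypothesis hd : (2 <= d)%N.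
Hypothesis bN : forall p M, 0 <= p -> p <= M%:R ->
  b p = 1 + \sum_(0 <= k < M) N (p / k.+1%:R).
Hypothesis bV : b p / p ^+ d @[p --> +oo] --> V.
Hypothesis NC : forall p, 0 < p -> `|N p| <= C * p ^+ d.
Implicit Type p : R.

Let Z := zeta (d%:R : R).
Let L := V / Z.
Let e p := N p / p ^+ d - L.
(** A common bound for [L] and for all errors; the final 1 makes it positive, so that it can be
    divided by. *)
Let C0 := C + `|L| + 1.

Let Z0 : 0 < Z. Proof. exact: lt_le_trans ltr01 (zeta_ge1 R hd). Qed.

Let C_ge0 : 0 <= C.
Proof. by have := NC ltr01; rewrite expr1n mulr1; apply: le_trans. Qed.

Let C0_gt0 : 0 < C0.
Proof. by rewrite /C0 ltr_wpDl // addr_ge0. Qed.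

Lemma inversion_error_bound p : 0 < p -> `|e p| <= C0.
Proof.
move=> p0; rewrite /e; apply: le_trans (ler_normB _ _) _.
have : `|N p / p ^+ d| <= C.
  rewrite normrM normfV (ger0_norm (exprn_ge0 d (ltW p0))).
  by rewrite ler_pdivrMr ?exprn_gt0 ?NC.
by rewrite /C0; lra.
Qed.

(** Substitute [N x = x ^+ d * (e x + L)] with [x = p / k.+1] into [bN], divide by [p ^+ d] and
    isolate the term [k = 0], which is [e p]. *)
Lemma inversion_error_rec p M : 0 < p -> (0 < M)%N -> p <= M%:R ->
  e p = ((b p - 1) / p ^+ d - V) + L * (Z - zeta_partial R d M)
        - \sum_(1 <= k < M) zeta_term R d k * e (p / k.+1%:R).
Proof.
move=> p0 M0 pM.
have pd0 : p ^+ d != 0 by rewrite expf_neq0 // gt_eqF.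
have E : (b p - 1) / p ^+ d =
    \sum_(0 <= k < M) zeta_term R d k * e (p / k.+1%:R) + L * zeta_partial R d M.
  rewrite (bN (ltW p0) pM) addrAC subrr add0r mulr_suml /zeta_partial mulr_sumr -big_split.
  apply: eq_bigr => k _; rewrite /e /zeta_term /=.
  have k0 : k.+1%:R ^+ d != 0 :> R by rewrite expf_neq0 // pnatr_eq0.
  rewrite expr_div_n; move: (N _) (k.+1%:R ^+ d) k0 (p ^+ d) pd0 => u v v0 w w0.
  by field; rewrite v0 w0.
rewrite (big_ltn M0) {1}/zeta_term expr1n invr1 mul1r mulr1 in E.
rewrite E /L; move: (e p) (bigop _ _ _) => u v.
by field; rewrite gt_eqF.
Qed.

(** The terms below a cutoff [K] contribute at most [(zeta d - 1) * A <= 3 / 4 * A], and three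
    remainders at most [A / 24] each: [3 / 4 + 3 / 24 = 7 / 8]. *)
Lemma inversion_error_contract (A : R) : 0 < A ->
  (\forall p \near +oo, `|e p| <= A) -> \forall p \near +oo, `|e p| <= 7 / 8 * A.
Proof.
move=> A0 [P [_ HP]].
have A24 : 0 < A / 24 by rewrite divr_gt0.
have LC : `|L| <= C0 by rewrite /C0; have := C_ge0; lra.
have [K K0 HK] := @zeta_tail R d hd (A / 24 / C0) (divr_gt0 A24 C0_gt0).
have bV' : (b p - 1) / p ^+ d @[p --> +oo] --> V.
  have inv0 : (p ^+ d)^-1 @[p --> +oo] --> (0 : R).
    rewrite (_ : (fun p => (p ^+ d)^-1) = (fun p => p^-1 ^+ d)); last first.
      by apply/funext => p; rewrite exprVn.
    have := @cvg_exprn R _ _ _ _ d (@cvg_invr_pinfty R); rewrite expr0n.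
    by rewrite (gtn_eqF (ltnW hd)); apply.
  rewrite (_ : (fun p => _) = (fun p => b p / p ^+ d - (p ^+ d)^-1)); last first.
    by apply/funext => p; rewrite mulrBl mul1r.
  by rewrite -[X in _ --> X]subr0; exact: cvgB.
near=> p.
have p0 : 0 < p by near: p; apply: nbhs_pinfty_gt; exact: num_real.
have h1 : `|(b p - 1) / p ^+ d - V| <= A / 24.
  rewrite distrC; apply: ltW; near: p; exact: cvgr_dist_lt.
have h2 : K%:R * (`|P| + 1) <= p by near: p; apply: nbhs_pinfty_ge; exact: num_real.
(* Above [p], as the recursion requires, and above [K], so that the zeta tail is small. *)
pose M := ((Num.trunc p).+1 + K)%N.
have M0 : (0 < M)%N by rewrite /M addSn.
have KM : (K <= M)%N by rewrite /M leq_addl.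
have pM : p <= M%:R.
  apply: (@le_trans _ _ (Num.trunc p).+1%:R); first exact/ltW/truncnS_gt.
  by rewrite ler_nat leq_addr.
have ZM : 0 <= Z - zeta_partial R d M by rewrite subr_ge0 zeta_partial_le_zeta.
have h3 : `|L * (Z - zeta_partial R d M)| <= A / 24.
  rewrite normrM (ger0_norm ZM); have := HK M KM; rewrite ler_pdivlMr // mulrC.
  by apply: le_trans; rewrite ler_wpM2r.
(* For [k < K] the argument [p / k.+1] exceeds [P], so the bound [A] applies. Later terms have only
   the bound [C0], but their weights add up to at most [A / 24 / C0]. *)
have small k : (k < K)%N -> `|e (p / k.+1%:R)| <= A.
  move=> kK; apply: HP; rewrite ltr_pdivlMr //.
  apply: lt_le_trans h2; apply: (@le_lt_trans _ _ (`|P| * K%:R)).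
    apply: (@le_trans _ _ (`|P| * k.+1%:R)); first by rewrite ler_wpM2r // ler_norm.
    by rewrite ler_wpM2l // ler_nat.
  by rewrite mulrC ltr_pM2l ?ltr0n // ltrDl.
have big k : `|e (p / k.+1%:R)| <= C0.
  by apply: inversion_error_bound; rewrite divr_gt0.
have S1 : `|\sum_(1 <= k < K) zeta_term R d k * e (p / k.+1%:R)| <= A * (zeta_partial R d K - 1).
  have -> : zeta_partial R d K - 1 = \sum_(1 <= k < K) zeta_term R d k.
    by rewrite -(zeta_partial1 R d) /zeta_partial (@big_cat_nat _ _ _ 1) //= addrAC subrr add0r.
  rewrite mulr_sumr; apply: le_trans (ler_norm_sum _ _ _) _.
  apply: ler_sum_nat => k /andP[_ kK].
  by rewrite normrM (ger0_norm (zeta_term_ge0 R d k)) mulrC ler_wpM2r ?zeta_term_ge0 ?small.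
have S2 : `|\sum_(K <= k < M) zeta_term R d k * e (p / k.+1%:R)| <=
    C0 * (zeta_partial R d M - zeta_partial R d K).
  have -> : zeta_partial R d M - zeta_partial R d K = \sum_(K <= k < M) zeta_term R d k.
    by rewrite /zeta_partial (@big_cat_nat _ _ _ K) //= addrAC subrr add0r.
  rewrite mulr_sumr; apply: le_trans (ler_norm_sum _ _ _) _.
  apply: ler_sum_nat => k _.
  by rewrite normrM (ger0_norm (zeta_term_ge0 R d k)) mulrC ler_wpM2r ?zeta_term_ge0.
have S2' : C0 * (zeta_partial R d M - zeta_partial R d K) <= A / 24.
  have := HK K (leqnn K); rewrite ler_pdivlMr // mulrC.
  apply: le_trans; rewrite ler_wpM2l ?(ltW C0_gt0) // lerD2r.
  exact: zeta_partial_le_zeta.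
have S1' : A * (zeta_partial R d K - 1) <= 3 / 4 * A.
  by rewrite mulrC ler_wpM2r ?(ltW A0) // ; have := @zeta_partial_le R d hd K; lra.
rewrite (inversion_error_rec p0 M0 pM) (@big_cat_nat _ _ _ K) //=.
move: h1 h3 S1 S2; set a1 := (_ - V); set a2 := L * _; set a3 := \sum_(1 <= _ < _) _.
set a4 := \sum_(K <= _ < _) _ => h1 h3 S1 S2.
apply: le_trans (ler_normB _ _) _; have := ler_normD a1 a2; have := ler_normD a3 a4; lra.
Unshelve. all: by end_near.
Qed.

Lemma inversion_limit : N p / p ^+ d @[p --> +oo] --> V / Z.
Proof.
have iter n : \forall p \near +oo, `|e p| <= (7 / 8) ^+ n * C0.
  elim: n => [|n IH].
    near=> p; rewrite expr0 mul1r; apply: inversion_error_bound.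
    by near: p; apply: nbhs_pinfty_gt; exact: num_real.
  have := @inversion_error_contract ((7 / 8) ^+ n * C0); rewrite mulrA -exprS; apply => //.
  by rewrite mulr_gt0 // exprn_gt0 // divr_gt0.
apply/cvgrPdist_le => eps eps0.
have q1 : `|7 / 8 : R| < 1 by rewrite ger0_norm ?divr_ge0 //; lra.
have /cvgrPdist_lt/(_ _ (divr_gt0 eps0 C0_gt0)) [n _ Hn] := cvg_expr q1.
have := Hn n (leqnn n); rewrite sub0r normrN ger0_norm ?exprn_ge0 ?divr_ge0 //.
rewrite ltr_pdivlMr // => He.
near=> p; rewrite distrC; apply: le_trans (ltW He).
by near: p; exact: iter.
Unshelve. all: by end_near.
Qed.

End Inversion.


(** * The diameter of the primitive zonotope and its growth *)

Section PrimitiveZonotopeDiameter.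
Variables (R : realType) (q : R) (hq : 1 <= q) (d : nat).
Implicit Type p : R.

Definition generator_vector p (x : fset_set (@generators R q d p)) : 'rV[R]_d :=
  toR R (val x).

Lemma zonotopeHE p : zonotopeH q d p = zonotope (@generator_vector p).
Proof.
have fin := @finite_generators R q hq d p.
(* There are finitely many generators, so the finitely supported sum is the genuine one and not its
   default value 0. *)
have sumE (f : 'rV[int]_d -> 'rV[R]_d) : \sum_(x \in @generators R q d p) f x =
    \sum_(x : fset_set (@generators R q d p)) f (val x).
  by rewrite fsbig_finite // big_seq_fsetE.
apply/seteqP; split=> v.
  move=> [f Hf <-]; rewrite sumE.
  have /choice [t Ht] (x : fset_set (@generators R q d p)) :
      exists t : R, 0 <= t <= 1 /\ f (val x) = t *: generator_vector x.
    have := valP x; rewrite in_fset_set // inE => /Hf [t].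
    rewrite /= in_itv /= => t01 <-; exists t; split=> //.
    by rewrite scaler0 add0r.
  exists t; first by move=> x; have [] := Ht x.
  by apply: eq_bigr => x _; have [_ ->] := Ht x.
move=> [t Ht <-].
exists (fun x => if insub x is Some u then t u *: toR R x else 0).
  move=> x Ax; case: insubP => [u _ ux|].
    exists (t u); first by rewrite /= in_itv /=; exact: Ht.
    by rewrite scaler0 add0r.
  by rewrite in_fset_set // => /negP; case; rewrite inE.
by rewrite sumE; apply: eq_bigr => x _; rewrite valK.
Qed.

Lemma diameter_zonotopeH p :
  Defs.diameter (zonotopeH q d p) = ((generator_count q d p)%:R)%:E.
Proof.
have fin := @finite_generators R q hq d p.
have gP (x : fset_set (@generators R q d p)) :
    coord_gcd (val x) = 1%N /\ first_nonzero_pos (val x).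
  by have := valP x; rewrite in_fset_set // inE => -[/primitive_pointE].
rewrite zonotopeHE zonotope_diameter.
- by rewrite /generator_count cardfE.
- move=> x y a b xy; have [x1 x2] := gP x; have [y1 y2] := gP y.
  by apply: primitive_independent.
- move=> x; have [_ /first_nonzero_neq0] := gP x; apply: contra => /eqP x0.
  apply/eqP/rowP => i; move/rowP/(_ i): x0; rewrite !mxE => /eqP.
  by rewrite intr_eq0 => /eqP.
Qed.

(** For [1 <= p] use [2 * p + 1 <= 3 * p]; for [p < 1] there is no generator. Small [p] matter
    because the inversion evaluates the count at all [p / k.+1] with [k < M]. *)
Lemma generator_count_le p : 0 < p ->
  `|2 * (generator_count q d p)%:R| <= 2 * 3 ^+ d * p ^+ d :> R.
Proof.
move=> p0; rewrite ger0_norm ?mulr_ge0 // -mulrA ler_pM2l //.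
have [p1|p1] := ltP p 1.
  have -> : generator_count q d p = 0%N.
    apply/eqP; rewrite cardfs_eq0; apply/eqP/fsetP => x; rewrite inE.
    apply/negbTE/negP; rewrite in_fset_set; last exact: finite_generators.
    rewrite inE => -[_ xp [i xi _]]; move: p1; rewrite ltNge => /negP; apply.
    apply: le_trans xp; apply: le_trans (abs_le_qnorm hq x i).
    by rewrite ler1n; lia.
  by rewrite mulr_ge0 ?exprn_ge0 // ltW.
apply: (@le_trans _ _ (ball_count q d p)%:R).
  rewrite ler_nat; apply: fsubset_leq_card; rewrite -fset_set_sub.
  - by move=> x [].
  - exact: finite_generators.
  - exact: finite_lattice_ball.
apply: le_trans (ball_count_le hq d (ltW p0)) _.
by rewrite -exprMn lerXn2r ?nnegrE ?addr_ge0 ?mulr_ge0 ?(ltW p0) //; lra.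
Qed.

Lemma generator_count_limit : (2 <= d)%N ->
  (generator_count q d p)%:R / p ^+ d @[p --> +oo] -->
    (2 * Gamma (1 / q + 1)) ^+ d / (2 * Gamma (d%:R / q + 1) * zeta (d%:R : R)).
Proof.
move=> hd; have d0 : (0 < d)%N by exact: ltnW.
have bN (p : R) (M : nat) : 0 <= p -> p <= M%:R -> (ball_count q d p)%:R =
    1 + \sum_(0 <= k < M) 2 * (generator_count q d (p / k.+1%:R))%:R :> R.
  move=> p0 pM; rewrite (ball_countE hq d p0 pM) -natr1 addrC natrM natr_sum.
  by rewrite mulr_sumr big_mkord.
have H := inversion_limit hd bN (ball_count_limit hq d0) generator_count_le.
rewrite (_ : (fun p => _) = (fun p => 2^-1 * (2 * (generator_count q d p)%:R / p ^+ d))).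
  rewrite (_ : _ / (_ * _) = 2^-1 * ((2 * Gamma (1 / q + 1)) ^+ d / Gamma (d%:R / q + 1)
    / zeta (d%:R : R))); last by rewrite !invfM; ring.
  by apply: cvgM; [exact: cvg_cst|exact: H].
by apply/funext => p; rewrite !mulrA mulVf // mul1r.
Qed.


End PrimitiveZonotopeDiameter.

Theorem theorem2p2 (R : realType) (d : nat) (q : R) (hd : (2 <= d)%N)
    (hq : 1 <= q) :
  (diameter (zonotopeH q d p) * ((p ^+ d)^-1)%:E)%E @[p --> +oo] -->
    ((2 * Gamma (1 / q + 1)) ^+ d
       / (2 * Gamma (d%:R / q + 1) * zeta d%:R))%:E.
Proof.
(* The diameter is finite for every [p], so the limit is one of real numbers. *)
apply: cvg_EFin.
  by apply: nearW => p; rewrite (diameter_zonotopeH hq d p).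
rewrite (_ : _ \o _ = fun p => (generator_count q d p)%:R / p ^+ d).
  exact: generator_count_limit.
by apply/funext => p; rewrite /= (diameter_zonotopeH hq d p).
Qed.
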